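(* Let $0<a<b<2\pi$. The angle $\theta$ determined by the ideal digital filter $L_{[a,b]}$ and the space $\mathbf{CF}_d$ of digital causal filters, and the distance $d(L_{[a,b]},\mathbf{CF}_d)$, are given by $$\theta=\arcsin\sqrt{\frac12-\frac{b-a}{4\pi}},\qquad d(L_{[a,b]},\mathbf{CF}_d)=\sqrt{\frac{b-a}{2\pi}}\,\sqrt{\frac12-\frac{b-a}{4\pi}}.$$ In particular, they are both functions of the length of the bandpass interval $[a,b]$. Moreover, they satisfy the following properties: (a) $0<\theta<\pi/4$, $\lim_{(b-a)\to0}\theta=\pi/4$, $\lim_{(b-a)\to2\pi}\theta=0$; (b) $\lim_{(b-a)\to0}d(L_{[a,b]},\mathbf{CF}_d)=\lim_{(b-a)\to2\pi}d(L_{[a,b]},\mathbf{CF}_d)=0$.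
   Context: Signals are complex valued. $\mathbf{F_d}$ is the normed space (with the operator norm) of digital filters, i.e. bounded linear operators $L:\ell^2(\mathbb{Z})\to\ell^\infty(\mathbb{Z})$ commuting with all integer shifts. Every $L\in\mathbf{F_d}$ is of the form $L=L_h$ for a unique $h\in\ell^2(\mathbb{Z})$, where $L_h(x)=x*h$ is discrete convolution; moreover $\|L_h\|=\|h\|_{\ell^2}$, and $\mathbf{F_d}$ is a Hilbert space with $\langle L_h,L_g\rangle=\langle h,g\rangle_{\ell^2}$. The discrete Fourier transform is $\mathcal{F}_d(\{x[n]\}_{n\in\mathbb{Z}})(w)=\sum_{n=-\infty}^{\infty}x[n]e^{-iwn}$, which satisfies $\|\mathcal{F}_d(x)\|_{L^2(0,2\pi)}^2=2\pi\|x\|_{\ell^2}^2$. The transfer function of $L_h$ is $H=\mathcal{F}_d(h)$ ($2\pi$-periodic). $\mathbf{CF}_d$ (the causal filters) is the set of all $L_h$, $h\in\ell^2(\mathbb{Z})$, with $h[n]=0$ for all $n<0$. For $0<a<b<2\pi$, the ideal filter $L_{[a,b]}$ is the digital filter $L_{h_{[a,b]}}$ whose transfer function is $\mathcal{F}_d(h_{[a,b]})=\chi_{[a,b]}$ on $(0,2\pi)$ (the indicator function of $[a,b]$). The distance is $d(L,M)=\inf_{K\in M}\|L-K\|$, and the angle determined by a nonzero filter $L$ and a closed subspace $M$ is $\arcsin\big(d(L,M)/\|L\|\big)\in[0,\pi/2]$. Limits as $(b-a)\to0$ or $(b-a)\to2\pi$ are over intervals with $0<a<b<2\pi$ whose length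 tends to $0$ or to $2\pi$. *)

(* Defs.v *)
From HB Require Import structures.
From mathcomp Require Import all_boot all_order all_algebra.
From mathcomp Require Import all_classical all_reals all_analysis.
From mathcomp.real_closed Require Import complex.
From mathcomp Require Import ring lra.

Set Implicit Arguments.
Unset Strict Implicit.
Unset Printing Implicit Defensive.

Import Order.TTheory GRing.Theory Num.Theory.
Import numFieldNormedType.Exports.

Local Open Scope classical_set_scope.
Local Open Scope ring_scope.
Local Open Scope complex_scope.

(* Re and Im are the projections R[i] -> R, not the R[i]-valued 'Re and 'Im. *)
Notation Re := (@complex.Re _).
Notation Im := (@complex.Im _).

(* The real-valued modulus: the norm `|z| of R[i] is itself an element of
   R[i]. *)
Notation cmod := (@ComplexField.Normc.normc _).

Section Sums.
Context {R : realType}.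
Implicit Types (f g : int -> R) (u v : int -> R[i]).

(* Unconditional sums over Z; meaningful for absolutely summable families. *)
Definition zsumR f : R :=
  fine (\esum_(k in [set: int]) ((EFin \o f)^\+ k)%E)
  - fine (\esum_(k in [set: int]) ((EFin \o f)^\- k)%E).

Definition zsum u : R[i] :=
  zsumR (fun k => Re (u k)) +i* zsumR (fun k => Im (u k)).

Definition zsummable u := summable [set: int] (fun k => (cmod (u k))%:E).

Lemma cmod_ge0 (z : R[i]) : 0 <= cmod z.
Proof. by case: z => a b; exact: sqrtr_ge0. Qed.

Lemma cmod0 : cmod (0 : R[i]) = 0 :> R.
Proof. exact: ComplexField.Normc.normc0. Qed.

Lemma cmodE (z : R[i]) : cmod z ^+ 2 = Re z ^+ 2 + Im z ^+ 2.
Proof. by case: z => a b; rewrite /= sqr_sqrtr// addr_ge0 ?sqr_ge0. Qed.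

Lemma cmodD (z w : R[i]) : cmod (z + w) <= cmod z + cmod w.
Proof. exact: le_normcD. Qed.

Lemma cmodM (z w : R[i]) : cmod (z * w) = cmod z * cmod w.
Proof. exact: ComplexField.Normc.normcM. Qed.

Lemma normr_Re (z : R[i]) : `|Re z| <= cmod z.
Proof.
by rewrite -ler_sqr ?nnegrE ?cmod_ge0// cmodE real_normK ?num_real// lerDl sqr_ge0.
Qed.

Lemma normr_Im (z : R[i]) : `|Im z| <= cmod z.
Proof.
by rewrite -ler_sqr ?nnegrE ?cmod_ge0// cmodE real_normK ?num_real// lerDr sqr_ge0.
Qed.

Lemma cmod_le_ReIm (z : R[i]) : cmod z <= `|Re z| + `|Im z|.
Proof.
rewrite -ler_sqr ?nnegrE ?cmod_ge0 ?addr_ge0// cmodE sqrrD !real_normK ?num_real//.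
by rewrite lerD2r lerDl mulrn_wge0// mulr_ge0.
Qed.

Lemma summable_le (F G : int -> R) : (forall k, `|F k| <= `|G k|) ->
  summable setT (EFin \o G) -> summable setT (EFin \o F).
Proof.
by move=> FG; apply: le_lt_trans; apply: le_esum => k _; rewrite lee_fin.
Qed.

Lemma esum_pZl (c : R) (F : int -> R) : 0 < c ->
  (\esum_(k in setT) (c * F k)%:E = c%:E * \esum_(k in setT) (F k)%:E)%E.
Proof.
move=> c0; rewrite /esum -ereal_sup_pZl//; congr ereal_sup.
have E A : fsets [set: int] A ->
    (\sum_(x \in A) (c * F x)%:E = c%:E * \sum_(x \in A) (F x)%:E)%E.
  by move=> [finA _]; rewrite !fsumEFin// -EFinM -mulr_fsumr.
apply/seteqP; split => [_ [A fA <-]|_ [_ [A fA <-] <-]] /=.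
  by exists (\sum_(x \in A) (F x)%:E)%E; [exists A|rewrite E].
by exists A => //; rewrite E.
Qed.

Lemma summableZ (c : R) (F : int -> R) :
  summable setT (EFin \o F) -> summable setT (fun k => (c * F k)%:E).
Proof.
move=> sF; have : (\esum_(k in setT) ((`|c| + 1) * `|F k|)%:E < +oo)%E.
  rewrite esum_pZl ?ltr_wpDl//; move: sF; rewrite summableE => /fineK <-.
  by rewrite -EFinM ltry.
apply: le_lt_trans; apply: le_esum => k _.
by rewrite lee_fin normrM ler_wpM2r// lerDl.
Qed.

Lemma summable_fin (F : int -> R) : (forall k, 0 <= F k) ->
  summable setT (EFin \o F) -> (\esum_(k in setT) (F k)%:E)%E \is a fin_num.
Proof.
move=> F0; rewrite summableE (@eq_esum _ _ _ _ (EFin \o F))// => k _ /=.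
by rewrite ger0_norm.
Qed.

Lemma zsumR_sub (F G : int -> R) :
  (forall k, 0 <= F k) -> (forall k, 0 <= G k) ->
  summable setT (EFin \o F) -> summable setT (EFin \o G) ->
  zsumR (fun k => F k - G k) =
  fine (\esum_(k in setT) (F k)%:E) - fine (\esum_(k in setT) (G k)%:E).
Proof.
move=> F0 G0 sF sG.
pose H : int -> \bar R := EFin \o (fun k => F k - G k).
have sH : summable setT H by exact: summableB sF sG.
have fp : (\esum_(k in setT) H^\+ k)%E \is a fin_num.
  have := summable_funepos sH; rewrite summableE (@eq_esum _ _ _ _ H^\+%E)//.
  by move=> k _; rewrite gee0_abs// funepos_ge0.
have fn : (\esum_(k in setT) H^\- k)%E \is a fin_num.
  have := summable_funeneg sH; rewrite summableE (@eq_esum _ _ _ _ H^\-%E)//.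
  by move=> k _; rewrite gee0_abs// funeneg_ge0.
rewrite /zsumR -!fineB ?summable_fin//; congr fine.
by apply: (esumB sF sG) => k _; rewrite lee_fin.
Qed.

Lemma maxr0_sub (t : R) : t = Num.max t 0 - Num.max (- t) 0.
Proof. by rewrite /Num.max; case: ltP => ?; case: ltP => ?; lra. Qed.

Lemma normr_max (t : R) : `|t| = Num.max t 0 + Num.max (- t) 0.
Proof.
rewrite /Num.max; case: (ltP t 0) => h; case: (ltP (- t) 0) => ?.
- by lra.
- by rewrite ltr0_norm//; lra.
- by rewrite ger0_norm//; lra.
- by rewrite ger0_norm//; lra.
Qed.

Lemma max0_ge0 (t : R) : 0 <= Num.max t 0.
Proof. by rewrite le_max lexx orbT. Qed.

Lemma max0_le_norm (t : R) : Num.max t 0 <= `|t|.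
Proof. by rewrite normr_max lerDl max0_ge0. Qed.

Lemma summable_max0 (F : int -> R) : summable setT (EFin \o F) ->
  summable setT (EFin \o (fun k => Num.max (F k) 0)).
Proof.
by apply: summable_le => k; rewrite (ger0_norm (max0_ge0 _)) max0_le_norm.
Qed.

Lemma summable_opp (F : int -> R) : summable setT (EFin \o F) ->
  summable setT (EFin \o (fun k => - F k)).
Proof. by apply: summable_le => k; rewrite normrN. Qed.

Lemma summable_add (F G : int -> R) : summable setT (EFin \o F) ->
  summable setT (EFin \o G) -> summable setT (EFin \o (fun k => F k + G k)).
Proof. by move=> sF sG; exact: summableD sF sG. Qed.

Lemma zsumR_posneg (F : int -> R) : summable setT (EFin \o F) ->
  zsumR F = fine (\esum_(k in setT) (Num.max (F k) 0)%:E)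
          - fine (\esum_(k in setT) (Num.max (- F k) 0)%:E).
Proof.
move=> sF; rewrite -zsumR_sub//; [|by move=> ?; exact: max0_ge0..| |].
- by congr zsumR; apply/funext => k; exact: maxr0_sub.
- exact: summable_max0.
- exact/summable_max0/summable_opp.
Qed.

Lemma zsumR_le_norm (F : int -> R) : summable setT (EFin \o F) ->
  `|zsumR F| <= fine (\esum_(k in setT) `|F k|%:E).
Proof.
move=> sF; rewrite zsumR_posneg//.
have E0 G : 0 <= fine (\esum_(k in [set: int]) (Num.max (G k : R) 0)%:E).
  by rewrite fine_ge0// esum_ge0// => k _; rewrite lee_fin max0_ge0.
have -> : (\esum_(k in setT) `|F k|%:E = \esum_(k in setT) (Num.max (F k) 0)%:E
    + \esum_(k in setT) (Num.max (- F k) 0)%:E)%E.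
  rewrite -esumD; [|by move=> k _; rewrite lee_fin max0_ge0..].
  by apply: eq_esum => k _; rewrite normr_max.
have mF := summable_max0 sF; have mN := summable_max0 (summable_opp sF).
rewrite fineD; [|by apply: summable_fin => // k; exact: max0_ge0..].
have := E0 F; have := E0 (fun k => - F k).
by rewrite ler_norml; lra.
Qed.

Lemma zsumRD (F G : int -> R) : summable setT (EFin \o F) ->
  summable setT (EFin \o G) -> zsumR (fun k => F k + G k) = zsumR F + zsumR G.
Proof.
move=> sF sG.
have m0 (t : R) : 0 <= Num.max t 0 by exact: max0_ge0.
have mF := summable_max0 sF; have mFN := summable_max0 (summable_opp sF).
have mG := summable_max0 sG; have mGN := summable_max0 (summable_opp sG).
have -> : (fun k => F k + G k) = (fun k =>
    (Num.max (F k) 0 + Num.max (G k) 0)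
    - (Num.max (- F k) 0 + Num.max (- G k) 0)).
  apply/funext => k; rewrite {1}(maxr0_sub (F k)) {1}(maxr0_sub (G k)).
  by ring.
rewrite zsumR_sub; [|by move=> k; rewrite addr_ge0..|
  exact: summable_add|exact: summable_add].
have ED (f g : int -> R) : (forall k, 0 <= f k) -> (forall k, 0 <= g k) ->
    summable setT (EFin \o f) -> summable setT (EFin \o g) ->
    fine (\esum_(k in setT) (f k + g k)%:E) =
    fine (\esum_(k in setT) (f k)%:E) + fine (\esum_(k in setT) (g k)%:E).
  move=> f0 g0 sf sg; rewrite -fineD ?summable_fin// -esumD// => k _.
  - by rewrite lee_fin.
  - by rewrite lee_fin.
rewrite (ED _ _ _ _ mF mG)// (ED _ _ _ _ mFN mGN)//.
by rewrite (zsumR_posneg sF) (zsumR_posneg sG) opprD addrACA.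
Qed.

Lemma zsumRZ (c : R) (F : int -> R) : summable setT (EFin \o F) ->
  zsumR (fun k => c * F k) = c * zsumR F.
Proof.
have pos (d : R) (G : int -> R) : 0 < d -> summable setT (EFin \o G) ->
    zsumR (fun k => d * G k) = d * zsumR G.
  move=> d0 sG; rewrite !zsumR_posneg//; last exact: summableZ.
  have mG := summable_max0 sG; have mN := summable_max0 (summable_opp sG).
  have dmax (t : R) : Num.max (d * t) 0 = d * Num.max t 0.
    by rewrite maxr_pMr ?ltW// mulr0.
  under eq_esum do rewrite dmax.
  under [X in _ - fine X]eq_esum do rewrite -mulrN dmax.
  rewrite !esum_pZl// !fineM// -?mulrBr//;
    by apply: summable_fin => // k; exact: max0_ge0.
move=> sF; have [c0|c0|->] := ltgtP c 0; last 1 first.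
- have s0 : summable setT (EFin \o (fun k => 0 * F k)) by exact: summableZ.
  rewrite mul0r zsumR_posneg//.
  by apply/eqP; rewrite subr_eq0; apply/eqP; congr fine; apply: eq_esum => k _;
     rewrite mul0r oppr0.
- have -> : (fun k => c * F k) = (fun k => - c * - F k).
    by apply/funext => k; rewrite mulrNN.
  rewrite pos ?oppr_gt0//; last exact: summable_opp.
  have -> : zsumR (fun k => - F k) = - zsumR F.
    rewrite !zsumR_posneg//; last exact: summable_opp.
    under [X in _ - fine X]eq_esum do rewrite opprK.
    by rewrite opprB.
  by rewrite mulrNN.
- exact: pos.
Qed.

Lemma set_bij_shift (m : int) :
  set_bij [set: int] [set: int] (fun k => k + m).
Proof.
split => // [a b _ _ /addIr//|k _].
by exists (k - m) => //; rewrite subrK.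
Qed.

Lemma set_bij_rev (m : int) :
  set_bij [set: int] [set: int] (fun k => m - k).
Proof.
split => // [a b _ _ /addrI/oppr_inj//|k _].
by exists (m - k) => //; rewrite opprB addrC subrK.
Qed.

Lemma zsumR_shift (m : int) (F : int -> R) :
  zsumR (fun k => F (k + m)) = zsumR F.
Proof.
have E (a : int -> \bar R) :
    (\esum_(k in setT) a k = \esum_(k in setT) a (k + m)%R)%E.
  exact: (reindex_esum setT setT _ a (set_bij_shift m)).
rewrite /zsumR; congr (fine _ - fine _); rewrite [RHS]E; apply: eq_esum => k _.
- by rewrite !funeposE.
- by rewrite !funenegE.
Qed.

Lemma summable_bij (e : int -> int) (F : int -> R) :
  set_bij [set: int] [set: int] e ->
  summable setT (EFin \o F) -> summable setT (EFin \o (F \o e)).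
Proof.
move=> be; rewrite /summable.
by rewrite (reindex_esum setT setT e (fun k => `|(EFin \o F) k|%E) be).
Qed.

Lemma zsummable_Re u : zsummable u -> summable setT (EFin \o (fun k => Re (u k))).
Proof.
by apply: summable_le => k; rewrite (ger0_norm (cmod_ge0 _)) normr_Re.
Qed.

Lemma zsummable_Im u : zsummable u -> summable setT (EFin \o (fun k => Im (u k))).
Proof.
by apply: summable_le => k; rewrite (ger0_norm (cmod_ge0 _)) normr_Im.
Qed.

Lemma zsummableZ (c : R[i]) u : zsummable u -> zsummable (fun k => c * u k).
Proof.
move=> su; rewrite /zsummable; under eq_fun do rewrite cmodM.
exact: summableZ.
Qed.

Lemma zsumD u v : zsummable u -> zsummable v ->
  zsum (fun k => u k + v k) = zsum u + zsum v.
Proof.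
move=> su sv; rewrite /zsum.
have -> : (fun k => Re (u k + v k)) = (fun k => Re (u k) + Re (v k)).
  by apply/funext => k; case: (u k) (v k) => [? ?] [].
have -> : (fun k => Im (u k + v k)) = (fun k => Im (u k) + Im (v k)).
  by apply/funext => k; case: (u k) (v k) => [? ?] [].
rewrite (zsumRD (zsummable_Re su) (zsummable_Re sv)).
by rewrite (zsumRD (zsummable_Im su) (zsummable_Im sv)).
Qed.

Lemma zsumZ (c : R[i]) u : zsummable u ->
  zsum (fun k => c * u k) = c * zsum u.
Proof.
move=> su; have sR := zsummable_Re su; have sI := zsummable_Im su.
case: c => a b; rewrite /zsum.
have -> : (fun k => Re ((a +i* b) * u k)) =
    (fun k => a * Re (u k) + - b * Im (u k)).
  by apply/funext => k; case: (u k) => ? ? /=; rewrite mulNr.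
have -> : (fun k => Im ((a +i* b) * u k)) =
    (fun k => a * Im (u k) + b * Re (u k)).
  by apply/funext => k; case: (u k) => ? ? /=.
rewrite (zsumRD (summableZ a sR) (summableZ (- b) sI)).
rewrite (zsumRD (summableZ a sI) (summableZ b sR)).
rewrite (zsumRZ a sR) (zsumRZ (- b) sI) (zsumRZ a sI) (zsumRZ b sR).
by rewrite mulNr.
Qed.

Lemma cmod_zsum_le u : zsummable u ->
  cmod (zsum u) <= fine (\esum_(k in setT) (cmod (u k))%:E) *+ 2.
Proof.
move=> su; rewrite (le_trans (cmod_le_ReIm _))// mulr2n.
have fu := summable_fin (fun k => cmod_ge0 (u k)) su.
have sR := zsummable_Re su; have sI := zsummable_Im su.
apply: lerD => /=; apply: (le_trans (zsumR_le_norm _)) => //.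
- apply: fine_le => //; last first.
    by apply: le_esum => k _; rewrite lee_fin normr_Re.
  by apply: summable_fin => //; move: sR; rewrite /summable /=; under eq_esum do rewrite -normr_id.
- apply: fine_le => //; last first.
    by apply: le_esum => k _; rewrite lee_fin normr_Im.
  by apply: summable_fin => //; move: sI; rewrite /summable /=; under eq_esum do rewrite -normr_id.
Qed.

End Sums.

Section Spaces.
Variable R : realType.

Definition square_summable : {pred int -> R[i]} :=
  mem [set x : int -> R[i] |
    summable [set: int] (fun n => (cmod (x n) ^+ 2)%:E)].

Record ell2 := Ell2 {
  ell2_fun :> int -> R[i];
  _ : ell2_fun \in square_summable }.

Definition bounded_signal : {pred int -> R[i]} :=
  mem [set y : int -> R[i] | exists c : R, forall n, cmod (y n) <= c].

Record ellinf := Ellinf {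
  ellinf_fun :> int -> R[i];
  _ : ellinf_fun \in bounded_signal }.

HB.instance Definition _ := [isSub for ell2_fun].
HB.instance Definition _ := [Choice of ell2 by <:].
HB.instance Definition _ := [isSub for ellinf_fun].
HB.instance Definition _ := [Choice of ellinf by <:].

Lemma square_summable_submod_closed : submod_closed square_summable.
Proof.
split.
  apply/mem_set; rewrite /= -[summable _ _]/(summable [set: int]
    (fun=> (cmod (0 : R[i]) ^+ 2)%:E)) /summable esum1 ?ltry// => k _.
  by rewrite cmod0 expr0n/= normr0.
move=> a x y; rewrite !inE /= => sx sy.
have := summable_add (summableZ (2 * cmod a ^+ 2) sx) (summableZ 2 sy).
apply: (@summable_le _ (fun k => cmod ((a *: x + y) k) ^+ 2)) => k.
rewrite (ger0_norm (sqr_ge0 _)) ger0_norm; last first.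
  by apply: addr_ge0; apply: mulr_ge0; rewrite ?mulr_ge0 ?cmod_ge0.
have := cmodD (a * x k) (y k); rewrite cmodM.
rewrite -[(a *: x + y) k]/(a * x k + y k) => h.
have h1 : cmod (a * x k + y k) ^+ 2 <= (cmod a * cmod (x k) + cmod (y k)) ^+ 2.
  by rewrite lerXn2r// nnegrE ?addr_ge0 ?mulr_ge0 ?cmod_ge0.
rewrite (le_trans h1)// -subr_ge0.
have -> : 2 * cmod a ^+ 2 * cmod (x k) ^+ 2 + 2 * cmod (y k) ^+ 2
  - (cmod a * cmod (x k) + cmod (y k)) ^+ 2
  = (cmod a * cmod (x k) - cmod (y k)) ^+ 2 by ring.
exact: sqr_ge0.
Qed.

HB.instance Definition _ := GRing.isSubmodClosed.Build _ _ square_summable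
  square_summable_submod_closed.
HB.instance Definition _ := [SubChoice_isSubLmodule of ell2 by <:].

Lemma bounded_signal_submod_closed : submod_closed bounded_signal.
Proof.
split.
  by apply/mem_set; exists 0 => n; rewrite -[cmod _]/(cmod (0 : R[i])) cmod0.
move=> a x y; rewrite !inE /= => -[c xc] [d yd]; exists (cmod a * c + d) => n.
rewrite (le_trans (cmodD _ _))// lerD// cmodM ler_wpM2l// cmod_ge0//.
Qed.

HB.instance Definition _ := GRing.isSubmodClosed.Build _ _ bounded_signal
  bounded_signal_submod_closed.
HB.instance Definition _ := [SubChoice_isSubLmodule of ellinf by <:].

Definition ell2_norm (x : ell2) : R :=
  Num.sqrt (fine (\esum_(n in [set: int]) (cmod (x n) ^+ 2)%:E)).

Definition ellinf_norm (y : ellinf) : R := sup (range (fun n => cmod (y n))).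

Lemma ell2_summable (x : ell2) :
  summable [set: int] (fun n => (cmod (x n) ^+ 2)%:E).
Proof. by case: x => x /=; rewrite inE. Qed.

Lemma ell2_shift_subproof (m : int) (x : ell2) :
  (fun n => x (n - m)) \in square_summable.
Proof.
rewrite inE /=.
exact: (summable_bij (set_bij_shift (- m)) (ell2_summable x)).
Qed.

Definition ell2_shift m x := Ell2 (ell2_shift_subproof m x).

Lemma ellinf_shift_subproof (m : int) (y : ellinf) :
  (fun n => y (n - m)) \in bounded_signal.
Proof.
by case: y => y /=; rewrite !inE /= => -[c yc]; exists c => n; exact: yc.
Qed.

Definition ellinf_shift m y := Ellinf (ellinf_shift_subproof m y).

Definition bounded_operator (L : ell2 -> ellinf) :=
  exists c : R, forall x, ellinf_norm (L x) <= c * ell2_norm x.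

Definition shift_equivariant (L : ell2 -> ellinf) :=
  forall (m : int) (x : ell2), L (ell2_shift m x) = ellinf_shift m (L x).

Record digital_filter := DigitalFilter {
  filter_fun :> {linear ell2 -> ellinf};
  _ : bounded_operator filter_fun;
  _ : shift_equivariant filter_fun }.

(* A supremum of real numbers: meaningful for bounded L only. *)
Definition operator_norm (L : ell2 -> ellinf) : R :=
  sup [set ellinf_norm (L x) | x in [set x | ell2_norm x <= 1]].

Definition filter_distance (L : digital_filter) (M : set digital_filter) : R :=
  inf [set operator_norm (fun x => L x - K x) | K in M].

Definition filter_angle (L : digital_filter) (M : set digital_filter) : R :=
  asin (filter_distance L M / operator_norm L).

Lemma conv_summable (x h : ell2) (n : int) :
  zsummable (fun k => x k * h (n - k)).
Proof.
have := summable_add (ell2_summable x)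
  (summable_bij (set_bij_rev n) (ell2_summable h)).
apply: summable_le => k /=; rewrite !ger0_norm ?cmod_ge0 ?addr_ge0 ?sqr_ge0//.
rewrite cmodM; have := sqr_ge0 (cmod (x k) - cmod (h (n - k))).
by have := cmod_ge0 (x k); have := cmod_ge0 (h (n - k)); nra.
Qed.

(* (x * h)[n] *)
Definition conv_fun (h x : ell2) (n : int) : R[i] :=
  zsum (fun k => x k * h (n - k)).

Lemma ell2_normE (x : ell2) :
  ell2_norm x ^+ 2 = fine (\esum_(n in [set: int]) (cmod (x n) ^+ 2)%:E).
Proof.
by rewrite sqr_sqrtr// fine_ge0// esum_ge0// => k _; rewrite lee_fin sqr_ge0.
Qed.

Lemma ell2_esumE (x : ell2) :
  (\esum_(n in [set: int]) (cmod (x n) ^+ 2)%:E = (ell2_norm x ^+ 2)%:E)%E.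
Proof.
rewrite ell2_normE fineK//; apply: summable_fin (ell2_summable x) => k.
exact: sqr_ge0.
Qed.

Lemma ell2_norm_ge (x : ell2) n : cmod (x n) <= ell2_norm x.
Proof.
rewrite -ler_sqr ?nnegrE ?cmod_ge0 ?sqrtr_ge0// -lee_fin -ell2_esumE.
have <- : (\esum_(k in [set n]) (cmod (x k) ^+ 2)%:E = (cmod (x n) ^+ 2)%:E)%E.
  by rewrite esum_set1// lee_fin sqr_ge0.
rewrite [leLHS]esum_mkcond; apply: le_esum => k _.
by case: ifP => // _; rewrite lee_fin sqr_ge0.
Qed.

Lemma conv_bound (h x : ell2) n :
  cmod (conv_fun h x n) <= ell2_norm x * ell2_norm h *+ 4.
Proof.
have [x0|] := eqVneq (ell2_norm x) 0.
  have xE k : x k = 0.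
    apply: ComplexField.Normc.eq0_normc; apply/eqP; rewrite eq_le cmod_ge0 andbT.
    by rewrite -x0 ell2_norm_ge.
  rewrite x0 mul0r mul0rn (le_trans (cmod_zsum_le (conv_summable _ _ _)))//.
  rewrite esum1 ?mul0rn// => k _.
  by rewrite xE mul0r cmod0.
have [h0 _|] := eqVneq (ell2_norm h) 0.
  have hE k : h k = 0.
    apply: ComplexField.Normc.eq0_normc; apply/eqP; rewrite eq_le cmod_ge0 andbT.
    by rewrite -h0 ell2_norm_ge.
  rewrite h0 mulr0 mul0rn (le_trans (cmod_zsum_le (conv_summable _ _ _)))//.
  rewrite esum1 ?mul0rn// => k _.
  by rewrite hE mulr0 cmod0.
move=> hn xn; set X := ell2_norm x; set H := ell2_norm h.
have X0 : 0 < X by rewrite lt_neqAle eq_sym xn sqrtr_ge0.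
have H0 : 0 < H by rewrite lt_neqAle eq_sym hn sqrtr_ge0.
rewrite (le_trans (cmod_zsum_le (conv_summable _ _ _)))//.
rewrite -[4%N]/(2 * 2)%N mulrnA ler_wMn2r//.
have : (\esum_(k in [set: int]) (cmod (x k * h (n - k)))%:E
    <= (X * H *+ 2)%:E)%E.
  have sr := summable_bij (set_bij_rev n) (ell2_summable h).
  have Er : (\esum_(k in [set: int]) (cmod (h (n - k)) ^+ 2)%:E
      = (H ^+ 2)%:E)%E.
    rewrite -ell2_esumE; apply/esym.
    exact: (reindex_esum setT setT _ (fun k => (cmod (h k) ^+ 2)%:E)
      (set_bij_rev n)).
  have -> : ((X * H *+ 2)%:E =
      \esum_(k in [set: int]) (H / X * cmod (x k) ^+ 2
        + X / H * cmod (h (n - k)) ^+ 2)%:E)%E.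
    rewrite (@eq_esum _ _ _ _ (fun k => (H / X * cmod (x k) ^+ 2)%:E
        + (X / H * cmod (h (n - k)) ^+ 2)%:E)%E)//.
    rewrite esumD; last 2 first.
    - by move=> k _; rewrite lee_fin mulr_ge0 ?sqr_ge0// divr_ge0 ?ltW.
    - by move=> k _; rewrite lee_fin mulr_ge0 ?sqr_ge0// divr_ge0 ?ltW.
    rewrite !esum_pZl ?divr_gt0// ell2_esumE Er -!EFinM -EFinD; congr EFin.
    by rewrite -/X; field; rewrite !gt_eqF.
  apply: le_esum => k _; rewrite lee_fin cmodM.
  have := cmod_ge0 (x k); have := cmod_ge0 (h (n - k)).
  move: (cmod (x k)) (cmod (h (n - k))) => p q q0 p0.
  have S := sqr_ge0 (H * p - X * q).
  have -> : H / X * p ^+ 2 + X / H * q ^+ 2 =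
      ((H * p - X * q) ^+ 2 + 2 * (H * X) * (p * q)) / (H * X).
    by field; rewrite !gt_eqF.
  rewrite ler_pdivlMr ?mulr_gt0//.
  have : 0 <= p * q by rewrite mulr_ge0.
  have : 0 < H * X by rewrite mulr_gt0.
  by move: S; move: (_ ^+ 2) (H * X) (p * q) => A B C; nra.
rewrite -lee_fin fineK//.
apply: summable_fin (conv_summable _ _ _) => k; exact: cmod_ge0.
Qed.

Lemma conv_subproof (h x : ell2) : conv_fun h x \in bounded_signal.
Proof. by rewrite inE; eexists => n; exact: conv_bound. Qed.

Definition conv (h x : ell2) : ellinf := Ellinf (conv_subproof h x).

Lemma conv_is_linear (h : ell2) : linear (conv h).
Proof.
move=> a x y; apply/val_inj/funext => n.
rewrite -[LHS]/(zsum (fun k => (a * x k + y k) * h (n - k))).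
rewrite -[RHS]/(a * conv_fun h x n + conv_fun h y n).
rewrite -zsumZ; last exact: conv_summable.
rewrite -zsumD; [|exact/zsummableZ/conv_summable|exact: conv_summable].
by congr zsum; apply/funext => k; rewrite mulrDl mulrA.
Qed.

HB.instance Definition _ (h : ell2) :=
  GRing.isLinear.Build R[i] ell2 ellinf _ (conv h) (conv_is_linear h).

Lemma conv_bounded (h : ell2) : bounded_operator (conv h).
Proof.
exists (ell2_norm h *+ 4) => x; apply: ge_sup => [|_ [n _ <-]].
  by exists (cmod (conv h x 0)), 0.
by rewrite mulrnAl [ell2_norm h * _]mulrC conv_bound.
Qed.

Lemma conv_shift_equivariant (h : ell2) : shift_equivariant (conv h).
Proof.
move=> m x; apply/val_inj/funext => n /=.
rewrite /conv_fun /zsum /=; congr (_ +i* _).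
  rewrite -[LHS](zsumR_shift m); congr zsumR; apply/funext => k.
  by rewrite addrK opprD [- k - m]addrC addrA.
rewrite -[LHS](zsumR_shift m); congr zsumR; apply/funext => k.
by rewrite addrK opprD [- k - m]addrC addrA.
Qed.

Definition Lfilter (h : ell2) : digital_filter :=
  @DigitalFilter (conv h) (conv_bounded h) (conv_shift_equivariant h).

Definition causal_filters : set digital_filter :=
  [set Lfilter h | h in [set h : ell2 | forall n : int, n < 0 -> h n = 0]].

(* e^{it} *)
Definition expi (t : R) : R[i] := cos t +i* sin t.

(* Since h is only square summable, the Fourier series converges in
   L^2(0, 2 pi), and a transfer function is determined up to null sets. *)
Definition dtft_partial_sum (h : int -> R[i]) (N : nat) (w : R) : R[i] :=
  \sum_(j < N.*2.+1) h (j%:Z - N%:Z) * expi (- w * (j%:Z - N%:Z)%:~R).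

Definition is_dtft (h : int -> R[i]) (H : R -> R[i]) : Prop :=
  [/\ measurable_fun `]0, 2 * pi[ (fun w => Re (H w)),
      measurable_fun `]0, 2 * pi[ (fun w => Im (H w)) &
      (\int[lebesgue_measure]_(w in `]0%R, (2 * pi)%R[)
        (cmod (dtft_partial_sum h N w - H w)%R ^+ 2)%:E)%E
      @[N --> \oo] --> 0%E].

(* For 0 < a < b < 2 pi exactly one h in l^2(Z) has this transfer function, so
   the default value 0 of xget is not taken. *)
Definition ideal_response (a b : R) : ell2 :=
  xget 0 [set h : ell2 | is_dtft h (fun w => (\1_(`[a, b]) w)%:C)].

Definition ideal_filter (a b : R) : digital_filter :=
  Lfilter (ideal_response a b).

(* (b - a) -> l along the pairs (a, b) with 0 < a < b < 2 pi *)
Definition bandwidth_to (l : R) : set_system (R * R) :=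
  filter_from (nbhs l) (fun U => [set ab : R * R |
    [/\ 0 < ab.1, ab.1 < ab.2, ab.2 < 2 * pi & U (ab.2 - ab.1)]]).

End Spaces.

Arguments causal_filters {R}.

(* Main.v *)
Require Import Defs.
From HB Require Import structures.
From mathcomp Require Import all_boot all_order all_algebra.
From mathcomp Require Import all_classical all_reals all_analysis.
From mathcomp Require Import measurable_realfun.
From mathcomp.real_closed Require Import complex.
From mathcomp Require Import zify ring lra.

Set Implicit Arguments.
Unset Strict Implicit.
Unset Printing Implicit Defensive.

Import Order.TTheory GRing.Theory Num.Theory.
Import numFieldNormedType.Exports.
(* Last, because convex combinations reuse the name conv, and the C-valued
   parts the names Re and Im. *)
Import Defs.

Local Open Scope classical_set_scope.
Local Open Scope ring_scope.


(** Write c = b - a, and let h be the impulse response of the ideal filter.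

    Filters as sequences.  The operator norm of x |-> x * h is the l^2 norm of
    h: Cauchy-Schwarz gives one inequality, and the reversed conjugate of h,
    normalized, attains it at time 0 ([operator_norm_conv]).  Subtracting a
    causal filter leaves the values h[n], n < 0, untouched and can cancel all
    the others, so the distance to the causal filters is the l^2 norm of h
    restricted to n < 0 ([filter_distance_causal]).

    The energy of h.  The transfer function is real, so |h[-n]| = |h[n]|, and
    Parseval says that the sum of all |h[n]|^2 is c / (2 pi).  Removing
    |h[0]|^2 = (c / (2 pi))^2 and halving gives the square of the distance,
    c / (2 pi) * (1/2 - c / (4 pi)); dividing by the norm gives the angle.

    Parseval.  For this h it amounts to the classical series
      sum_(n >= 1) (1 - cos (n c)) / n^2 = c (2 pi - c) / 4.
    The upper bound is Bessel's inequality.  For the lower bound the terms are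
    damped by the weights 1 - n / N.  The difference of the damped sum and
    c (2 pi - c) / 4 vanishes at 0, and its second derivative is Fejer's
    kernel, which is nonnegative and O(1/N) away from 0 and 2 pi; two uses of
    the mean value theorem bound it from below ([bernoulli_series_ge]).

    The impulse response.  The Fourier coefficients of the indicator of [a, b]
    are explicit ([ideal_coef]).  A best approximation identity
    ([dtft_error]) expresses the L^2 error of an arbitrary trigonometric sum
    as the distance of its coefficients to these plus the Bessel defect.  It
    gives Bessel's inequality, the L^2 convergence of the Fourier series once
    Parseval is known, and the uniqueness of h.

    The remaining claims are elementary: the angle and the distance are
    continuous functions of c. *)

(** * The series of (1 - cos (n c)) / n^2 *)

Section Fejer.
Context {R : realType}.
Implicit Types (t c x : R) (N : nat).

Lemma is_derive_fsum n (f df : nat -> R -> R) x :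
  (forall i, is_derive x 1 (f i) (df i x)) ->
  is_derive x 1 (fun y => \sum_(i < n) f i y) (\sum_(i < n) df i x).
Proof.
move=> H; have := @is_derive_sum R R R n (fun i => f i) x 1 (fun i => df i x)
  (fun i => H i).
by congr is_derive; apply/funext => y; rewrite fct_sumE.
Qed.

Lemma is_derive_cosM (m x : R) :
  is_derive x 1 (fun y => cos (m * y)) (- (m * sin (m * x))).
Proof.
apply: (is_derive_eq (is_derive1_comp (is_derive_cos _)
  (is_deriveZ m (is_derive_id x 1)))); rewrite /= /GRing.scale /=; ring.
Qed.

Lemma is_derive_sinM (m x : R) :
  is_derive x 1 (fun y => sin (m * y)) (m * cos (m * x)).
Proof.
apply: (is_derive_eq (is_derive1_comp (is_derive_sin _)
  (is_deriveZ m (is_derive_id x 1)))); rewrite /= /GRing.scale /=; ring.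
Qed.

Lemma is_derive_MVT (f df : R -> R) (a b : R) : a < b ->
  (forall x, is_derive x 1 f (df x)) ->
  exists2 c, a < c < b & f b - f a = df c * (b - a).
Proof.
move=> ab H; have [|c] := MVT ab (fun x _ => H x).
  apply: continuous_subspaceT => x.
  by apply/differentiable_continuous/derivable1_diffP; have [] := H x.
by rewrite in_itv /= => *; exists c.
Qed.

(** Here k stands for the frequency k + 1, so that the last weight is 0. *)
Definition fejer_weight N k : R := 1 - k.+1%:R / N%:R.

Definition fejer N t : R :=
  1 / 2 + \sum_(k < N) fejer_weight N k * cos (k.+1%:R * t).

(** Multiplying Dirichlet's kernel by 1 - cos t makes it telescope, since
    2 cos (n t) (1 - cos t) is a second difference of cosines. *)
Lemma dirichletE N t : 2 * (1 - cos t) * (1 / 2 + \sum_(k < N) cos (k.+1%:R * t))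
  = cos (N%:R * t) - cos (N.+1%:R * t).
Proof.
elim: N => [|N IH].
  by rewrite big_ord0 mul0r cos0 [1%:R * t]mul1r; field.
rewrite big_ord_recr /= addrA mulrDr IH.
have -> : N.+2%:R * t = N.+1%:R * t + t by rewrite -natr1 mulrDl mul1r.
have -> : N%:R * t = N.+1%:R * t - t by rewrite -natr1 mulrDl mul1r addrK.
by rewrite cosB cosD; ring.
Qed.

(** Fejer's kernel is a mean of Dirichlet kernels, so a second telescoping
    turns the closed form of the latter into this one, from which both the sign
    and the decay of the kernel are visible. *)
Lemma fejerE N t : (0 < N)%N ->
  2 * N%:R * (1 - cos t) * fejer N t = 1 - cos (N%:R * t).
Proof.
move=> N0.
(* T M is M times the kernel, the form in which M |-> M + 1 adds one Dirichlet
   kernel. *)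
pose T M := M%:R / 2 + \sum_(k < M) (M%:R - k.+1%:R) * cos (k.+1%:R * t).
have -> : 2 * N%:R * (1 - cos t) * fejer N t = 2 * (1 - cos t) * T N.
  rewrite [2 * _]mulrC -[_ * 2 * _]mulrA mulrAC -[LHS]mulrC; congr (_ * _).
  rewrite /fejer mulrDr mulr_sumr /T div1r; congr (_ + _).
  apply: eq_bigr => k _; rewrite mulrA; congr (_ * _).
  by rewrite /fejer_weight mulrBr mulr1 mulrCA divff ?mulr1// pnatr_eq0 -lt0n.
elim: N {N0} => [|N IH].
  by rewrite /T big_ord0 !mul0r cos0 addr0 mulr0 subrr.
have -> : T N.+1 = T N + (1 / 2 + \sum_(k < N) cos (k.+1%:R * t)).
  rewrite /T big_ord_recr /= subrr mul0r addr0 addrACA -big_split /=.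
  congr (_ + _); first by rewrite -natr1 mulrDl.
  by apply: eq_bigr => k _; rewrite -natr1; ring.
by rewrite mulrDr dirichletE IH; ring.
Qed.

Lemma cos_lt1 t : 0 < t < 2 * pi -> cos t < 1.
Proof.
move=> /andP[t0 t2].
have h (s : R) : 0 < s <= pi -> cos s < 1.
  move=> /andP[s0 sp]; rewrite -cos0 ltr_cos// in_itv /= ?lexx ?pi_ge0//.
  by rewrite sp ltW.
have [tp|tp] := leP t pi; first by apply: h; rewrite t0 tp.
have -> : cos t = cos (2 * pi - t).
  by rewrite -[RHS]cosN opprB mulr_natl -[RHS]cosD2pi subrK.
by apply: h; lra.
Qed.

Lemma fejer_ge0 N t : (0 < N)%N -> 0 < t < 2 * pi -> 0 <= fejer N t.
Proof.
move=> N0 /cos_lt1 t1; have := fejerE t N0; have := cos_le1 (N%:R * t).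
move=> h1 h2; rewrite -(@pmulr_rge0 _ (2 * N%:R * (1 - cos t))).
  by rewrite h2 subr_ge0.
by rewrite !mulr_gt0 ?ltr0n// subr_gt0.
Qed.

Lemma fejer_le N t : (0 < N)%N -> 0 < t < 2 * pi ->
  fejer N t <= (N%:R * (1 - cos t))^-1.
Proof.
move=> N0 /cos_lt1 t1; have := fejerE t N0; have := cos_geN1 (N%:R * t).
have P : 0 < N%:R * (1 - cos t) by rewrite !mulr_gt0 ?ltr0n// subr_gt0.
move=> h1 h2; rewrite -(ler_pM2l P) divff ?gt_eqF//; move: h2.
by rewrite -!mulrA; lra.
Qed.

(** The derivative of [fejer_defect]. *)
Definition fejer_slope N c : R :=
  \sum_(k < N) fejer_weight N k / k.+1%:R * sin (k.+1%:R * c) - (pi - c) / 2.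

(** How far the damped series is from its expected sum.  Differentiating twice
    removes the denominators and leaves Fejer's kernel. *)
Definition fejer_defect N c : R :=
  \sum_(k < N) fejer_weight N k / k.+1%:R ^+ 2 * (1 - cos (k.+1%:R * c))
  - c * (2 * pi - c) / 4.

Lemma is_derive_fejer_slope N x :
  is_derive x 1 (fejer_slope N) (fejer N x).
Proof.
have H1 : is_derive x 1 (fun y => \sum_(k < N) fejer_weight N k / k.+1%:R * sin (k.+1%:R * y))
    (\sum_(k < N) fejer_weight N k * cos (k.+1%:R * x)).
  apply: (@is_derive_fsum N
    (fun k y => fejer_weight N k / k.+1%:R * sin (k.+1%:R * y))
    (fun k y => fejer_weight N k * cos (k.+1%:R * y))) => k.
  apply: (is_derive_eq (is_deriveZ _ (is_derive_sinM k.+1%:R x))); rewrite /GRing.scale /=.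
  by rewrite mulrA divfK// pnatr_eq0.
have H2 : is_derive x 1 (fun y : R => (y - pi) / 2) (1 / 2).
  have -> : (fun y : R => (y - pi) / 2) = 2^-1 \*: (id + cst (- pi)).
    by apply/funext => y; rewrite /= /GRing.scale /= mulrC.
  by apply: is_derive_eq; rewrite /GRing.scale /=; lra.
have -> : fejer_slope N =
  (fun y => \sum_(k < N) fejer_weight N k / k.+1%:R * sin (k.+1%:R * y)) +
  (fun y : R => (y - pi) / 2).
  by apply/funext => y; rewrite /fejer_slope /=; congr (_ + _); lra.
by apply: is_derive_eq; rewrite addrC.
Qed.

Lemma is_derive_fejer_defect N x :
  is_derive x 1 (fejer_defect N) (fejer_slope N x).
Proof.
have H1 : is_derive x 1 (fun y => \sum_(k < N) fejer_weight N k / k.+1%:R ^+ 2 * (1 - cos (k.+1%:R * y)))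
    (\sum_(k < N) fejer_weight N k / k.+1%:R * sin (k.+1%:R * x)).
  apply: (@is_derive_fsum N
    (fun k y => fejer_weight N k / k.+1%:R ^+ 2 * (1 - cos (k.+1%:R * y)))
    (fun k y => fejer_weight N k / k.+1%:R * sin (k.+1%:R * y))) => k.
  have H := is_derive_cosM k.+1%:R x.
  have -> : (fun y => fejer_weight N k / k.+1%:R ^+ 2 * (1 - cos (k.+1%:R * y)))
    = (fejer_weight N k / k.+1%:R ^+ 2) \*: (cst 1 - (fun y => cos (k.+1%:R * y))).
    by [].
  apply: is_derive_eq; rewrite /GRing.scale /=.
  by rewrite sub0r opprK; field; rewrite ?pnatr_eq0.
have H2 : is_derive x 1 (fun y : R => y * (2 * pi - y) / 4) ((pi - x) / 2).
  have -> : (fun y : R => y * (2 * pi - y) / 4) = 4^-1 \*: (id * (cst (2 * pi) - id)).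
    by apply/funext => y; rewrite /= /GRing.scale /= mulrC.
  by apply: is_derive_eq; rewrite /GRing.scale /= -[(cst _ - id) x]/(2 * pi - x); field.
have -> : fejer_defect N =
  (fun y => \sum_(k < N) fejer_weight N k / k.+1%:R ^+ 2 * (1 - cos (k.+1%:R * y))) -
  (fun y : R => y * (2 * pi - y) / 4) by apply/funext.
exact: is_derive_eq.
Qed.

Lemma fejer_slope0 N : fejer_slope N 0 = - (pi / 2).
Proof. by rewrite /fejer_slope big1 ?subr0 ?sub0r// => k _; rewrite mulr0 sin0 mulr0. Qed.

Lemma sin_natpi k : sin (k%:R * pi) = 0 :> R.
Proof.
elim: k => [|k IH]; first by rewrite mul0r sin0.
by rewrite -natr1 mulrDl mul1r sinD IH sinpi mulr0 mul0r addr0.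
Qed.

Lemma fejer_slope_pi N : fejer_slope N pi = 0.
Proof.
rewrite /fejer_slope big1 ?subrr ?mul0r ?subr0// => k _.
by rewrite sin_natpi mulr0.
Qed.

Lemma fejer_defect0 N : fejer_defect N 0 = 0.
Proof.
rewrite /fejer_defect big1 ?mul0r ?subr0// => k _.
by rewrite mulr0 cos0 subrr mulr0.
Qed.

(** The slope of the defect increases, since its derivative is nonnegative; it
    starts at - pi / 2 and vanishes at pi.  So it is at least - pi / 2 on
    [0, d], whatever N is, and beyond d it is at least - pi times the bound of
    the kernel on [d, pi].  Integrating from 0, where the defect vanishes, gives
    the two terms. *)
Lemma fejer_defect_ge N (d c : R) : (0 < N)%N -> 0 < d -> d < c -> d < pi ->
  c < 2 * pi ->
  - (pi / 2 * d) - 2 * pi ^+ 2 / (N%:R * (1 - cos d)) <= fejer_defect N c.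
Proof.
move=> N0 d0 dc dp c2; have pi0 : 0 < pi :> R := pi_gt0 R.
set e := (N%:R * (1 - cos d))^-1.
have cd1 : cos d < 1 by apply: cos_lt1; lra.
have e0 : 0 < e by rewrite invr_gt0 mulr_gt0 ?ltr0n ?subr_gt0.
have hge x : 0 < x -> x < 2 * pi -> - (pi / 2) <= fejer_slope N x.
  move=> x0 x2; have [y /andP[y0 yx]] := is_derive_MVT x0 (is_derive_fejer_slope N).
  rewrite fejer_slope0 => E; have : 0 <= fejer N y by apply: fejer_ge0 => //; lra.
  by move: E; move: (fejer_slope _ _) (fejer _ _) => *; nra.
have hge' x : d < x -> x < 2 * pi -> - (pi * e) <= fejer_slope N x.
  move=> dx x2; have [xp|xp] := ltP x pi.
    have [y /andP[y0 yx]] := is_derive_MVT xp (is_derive_fejer_slope N).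
    rewrite fejer_slope_pi => E; have : fejer N y <= e.
      have y2 : 0 < y < 2 * pi by lra.
      apply: (le_trans (fejer_le N0 y2)); rewrite lef_pV2 ?posrE.
      - rewrite ler_pM2l ?ltr0n// lerD2l lerN2 ltW// ltr_cos ?in_itv /=; lra.
      - by rewrite mulr_gt0 ?ltr0n// subr_gt0 cos_lt1.
      - by rewrite mulr_gt0 ?ltr0n// subr_gt0.
    have : 0 <= fejer N y by apply: fejer_ge0 => //; lra.
    by move: E; move: (fejer_slope _ _) (fejer _ _) => *; nra.
  have [->|xp'] := eqVneq x pi.
    by rewrite fejer_slope_pi oppr_le0 mulr_ge0// ltW.
  have {xp xp'}xp : pi < x by rewrite lt_neqAle eq_sym xp' xp.
  have [y /andP[y0 yx]] := is_derive_MVT xp (is_derive_fejer_slope N).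
  rewrite fejer_slope_pi => E; have : 0 <= fejer N y by apply: fejer_ge0 => //; lra.
  by move: E; move: (fejer_slope _ _) (fejer _ _) => *; nra.
have [y1 /andP[y10 y1d]] := is_derive_MVT d0 (is_derive_fejer_defect N).
rewrite fejer_defect0 => E1.
have [y2 /andP[y20 y2c] E2] := is_derive_MVT dc (is_derive_fejer_defect N).
have := hge y1; have := hge' y2; move: E1 E2.
move: (fejer_defect N c) (fejer_defect N d) (fejer_slope _ _) (fejer_slope _ _).
move=> u v p q E1 E2 /(_ y20 (lt_trans y2c c2)) p1 /(_ y10) q1.
have {}q1 := q1 ltac:(lra).
have P1 : - (pi / 2 * d) <= v by nra.
have P2 : - (2 * pi ^+ 2 * e) <= u - v.
  rewrite E2; have : 0 <= pi * e by rewrite mulr_ge0// ltW.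
  have -> : 2 * pi ^+ 2 * e = (pi * e) * (2 * pi) by ring.
  by move: (pi * e) p1 => z; nra.
lra.
Qed.

(** The undamped sum dominates the damped one.  In [fejer_defect_ge], d makes
    the first error term at most e / 2 uniformly in N, then N does so for the
    second. *)
Lemma bernoulli_series_ge (c e : R) : 0 < c < 2 * pi -> 0 < e ->
  exists N, c * (2 * pi - c) / 4 - e <=
    \sum_(k < N) (1 - cos (k.+1%:R * c)) / k.+1%:R ^+ 2.
Proof.
move=> /andP[c0 c2] e0; have pi0 : 0 < pi :> R := pi_gt0 R.
pose d : R := Num.min (c / 2) (e / pi).
have d0 : 0 < d by rewrite lt_min !divr_gt0.
have dc : d < c by rewrite gt_min; apply/orP; left; lra.
have dp : d < pi by rewrite gt_min; apply/orP; left; lra.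
have de : pi / 2 * d <= e / 2.
  have : d <= e / pi by rewrite ge_min lexx orbT.
  by rewrite ler_pdivlMr//; lra.
have cd1 : 0 < 1 - cos d by rewrite subr_gt0 cos_lt1//; lra.
pose B : R := 4 * pi ^+ 2 / (e * (1 - cos d)).
have B0 : 0 <= B by rewrite divr_ge0 ?mulr_ge0 ?sqr_ge0 ?ltW.
pose N := (Num.truncn B).+1; exists N.
have NB : B < N%:R by exact: truncnS_gt.
have N0 : 0 < N%:R :> R by rewrite ltr0n.
have := @fejer_defect_ge N d c isT d0 dc dp c2.
have : 2 * pi ^+ 2 / (N%:R * (1 - cos d)) <= e / 2.
  move: NB; rewrite /B ltr_pdivrMr ?mulr_gt0// => NB.
  rewrite ler_pdivrMr ?mulr_gt0//; move: NB.
  have -> : e / 2 * (N%:R * (1 - cos d)) = (N%:R * (e * (1 - cos d))) / 2.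
    by ring.
  lra.
rewrite /fejer_defect => h1 h2.
have : \sum_(k < N) fejer_weight N k / k.+1%:R ^+ 2 * (1 - cos (k.+1%:R * c))
   <= \sum_(k < N) (1 - cos (k.+1%:R * c)) / k.+1%:R ^+ 2.
  apply: ler_sum => k _; rewrite mulrAC ler_wpM2r ?invr_ge0 ?sqr_ge0//.
  rewrite -[leRHS]mul1r ler_wpM2r ?subr_ge0 ?cos_le1//.
  by rewrite /fejer_weight gerBl divr_ge0.
lra.
Qed.

End Fejer.

(** * Trigonometric integrals and the L^2 error *)

Section TrigIntegrals.
Context {R : realType}.
Notation mu := (@lebesgue_measure R).

(** Continuity is carried along because it makes every integrand integrable, so
    that the rules of linearity have no side conditions. *)
Definition has_integral (a b : R) (f : R -> R) (v : R) :=
  continuous f /\ (\int[mu]_(x in `[a, b]) (f x)%:E = v%:E)%E.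

Lemma has_integral_integrable a b f v : has_integral a b f v ->
  mu.-integrable `[a, b] (EFin \o f).
Proof.
move=> [cf _]; apply: continuous_compact_integrable.
  exact: segment_compact.
exact: continuous_subspaceT.
Qed.

Lemma has_integral_FTC a b (F f : R -> R) : a < b ->
  (forall x : R, is_derive x 1 F (f x)) -> continuous f ->
  has_integral a b f (F b - F a).
Proof.
move=> ab dF cf; split=> //; rewrite EFinB.
have cF : continuous F.
  by move=> x; apply/differentiable_continuous/derivable1_diffP; have [] := dF x.
apply: continuous_FTC2 => //.
- exact: continuous_subspaceT.
- split; first by move=> x _; have [] := dF x.
    by apply: cvg_at_right_filter; exact: cF.
  by apply: cvg_at_left_filter; exact: cF.
- by move=> x _; rewrite derive1E; have [] := dF x.
Qed.

Lemma has_integralD a b f g v w : has_integral a b f v -> has_integral a b g w ->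
  has_integral a b (fun x => f x + g x) (v + w).
Proof.
move=> If Ig; split.
  by move=> x; apply: cvgD; [exact: If.1|exact: Ig.1].
have fi := has_integral_integrable If; have gi := has_integral_integrable Ig.
by rewrite EFinD -If.2 -Ig.2 -integralD_EFin.
Qed.

Lemma has_integralZ a b f v (k : R) : has_integral a b f v ->
  has_integral a b (fun x => k * f x) (k * v).
Proof.
move=> If; split.
  by move=> x; apply: cvgM; [exact: cvg_cst|exact: If.1].
have fi := has_integral_integrable If.
by rewrite EFinM -If.2 -integralZl.
Qed.

Lemma has_integral_sum a b n (f : 'I_n -> R -> R) (v : 'I_n -> R) :
  (forall i, has_integral a b (f i) (v i)) ->
  has_integral a b (fun x => \sum_(i < n) f i x) (\sum_(i < n) v i).
Proof.
elim: n f v => [|n IH] f v H.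
  split; first by under eq_fun do rewrite big_ord0; move=> x; exact: cvg_cst.
  by under eq_integral do rewrite big_ord0; rewrite big_ord0 integral0.
under eq_fun do rewrite big_ord_recr /=; rewrite big_ord_recr /=.
by apply: has_integralD => //; apply: IH => i; exact: H.
Qed.

Lemma has_integral_cst a b (k : R) : a < b ->
  has_integral a b (fun=> k) (k * (b - a)).
Proof.
move=> ab; rewrite mulrBr; apply: (@has_integral_FTC _ _ (k \*: id)) => //.
  move=> x; apply: (is_derive_eq (is_deriveZ _ (is_derive_id x 1))).
  exact: mulr1.
by move=> x; exact: cvg_cst.
Qed.

Lemma continuous_cosM (m : R) : continuous (fun x => cos (m * x)).
Proof.
move=> x; apply/differentiable_continuous/derivable1_diffP.
by have [] := is_derive_cosM m x.
Qed.

Lemma continuous_sinM (m : R) : continuous (fun x => sin (m * x)).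
Proof.
move=> x; apply/differentiable_continuous/derivable1_diffP.
by have [] := is_derive_sinM m x.
Qed.

Lemma has_integral_cosM a b (m : R) : a < b -> m != 0 ->
  has_integral a b (fun x => cos (m * x)) ((sin (m * b) - sin (m * a)) / m).
Proof.
move=> ab m0; rewrite mulrBl ![_ / m]mulrC.
apply: (@has_integral_FTC _ _ (m^-1 \*: (fun x => sin (m * x)))) => //.
  move=> x; apply: (is_derive_eq (is_deriveZ _ (is_derive_sinM m x))).
  by rewrite /GRing.scale /= mulKf.
exact: continuous_cosM.
Qed.

Lemma has_integral_sinM a b (m : R) : a < b -> m != 0 ->
  has_integral a b (fun x => sin (m * x)) ((cos (m * a) - cos (m * b)) / m).
Proof.
move=> ab m0.
have -> : (cos (m * a) - cos (m * b)) / m =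
  - m^-1 * cos (m * b) - (- m^-1 * cos (m * a)) by ring.
apply: (@has_integral_FTC _ _ (- m^-1 \*: (fun x => cos (m * x)))) => //.
  move=> x; apply: (is_derive_eq (is_deriveZ _ (is_derive_cosM m x))).
  by rewrite /GRing.scale /= mulrNN mulKf.
exact: continuous_sinM.
Qed.

Lemma cos_2pi_int (n : int) : cos (n%:~R * (2 * pi)) = 1 :> R.
Proof.
have H (k : nat) : cos (k%:R * (2 * pi)) = 1 :> R.
  elim: k => [|k IH]; first by rewrite mul0r cos0.
  by rewrite -natr1 mulrDl mul1r {2}[2 * pi]mulr_natl cosD2pi.
by case: n => k; rewrite ?NegzE ?mulrNz ?mulNr ?cosN H.
Qed.

Lemma sin_2pi_int (n : int) : sin (n%:~R * (2 * pi)) = 0 :> R.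
Proof.
have H (k : nat) : sin (k%:R * (2 * pi)) = 0 :> R.
  elim: k => [|k IH]; first by rewrite mul0r sin0.
  by rewrite -natr1 mulrDl mul1r {2}[2 * pi]mulr_natl sinD2pi.
by case: n => k; rewrite ?NegzE ?mulrNz ?mulNr ?sinN H ?oppr0.
Qed.

Lemma has_integral_cos_period (n : int) :
  has_integral 0 (2 * pi) (fun x => cos (n%:~R * x)) (2 * pi * (n == 0)%:R).
Proof.
have p0 : 0 < 2 * pi :> R by rewrite mulr_gt0 ?pi_gt0.
have [->|n0] := eqVneq n 0.
  under eq_fun do rewrite mul0r cos0.
  by have := has_integral_cst 1 p0; rewrite mul1r subr0 mulr1.
have m0 : n%:~R != 0 :> R by rewrite intr_eq0.
have := has_integral_cosM p0 m0.
by rewrite sin_2pi_int mulr0 sin0 subrr mul0r mulr0.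
Qed.

Lemma has_integral_sin_period (n : int) :
  has_integral 0 (2 * pi) (fun x => sin (n%:~R * x)) 0.
Proof.
have p0 : 0 < 2 * pi :> R by rewrite mulr_gt0 ?pi_gt0.
have [->|n0] := eqVneq n 0.
  under eq_fun do rewrite mul0r sin0.
  by have := has_integral_cst 0 p0; rewrite mul0r.
have m0 : n%:~R != 0 :> R by rewrite intr_eq0.
have := has_integral_sinM p0 m0.
by rewrite cos_2pi_int mulr0 cos0 subrr mul0r.
Qed.

(** The term j of [dtft_partial_sum] runs over the frequencies - N, ..., N. *)
Definition freq (N j : nat) : int := j%:Z - N%:Z.

Implicit Types (z : int -> R[i]).

Lemma Re_dtft z N w : Re (dtft_partial_sum z N w) =
  \sum_(j < N.*2.+1) (Re (z (freq N j)) * cos ((freq N j)%:~R * w)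
                    + Im (z (freq N j)) * sin ((freq N j)%:~R * w)).
Proof.
rewrite /dtft_partial_sum (@big_morph _ _ (@complex.Re R) 0 +%R 0 +%R)//.
  apply: eq_bigr => j _; rewrite -/(freq N j) mulNr [w * _]mulrC /expi cosN sinN.
  by case: (z _) => p q /=; ring.
by case=> ? ? [].
Qed.

Lemma Im_dtft z N w : Im (dtft_partial_sum z N w) =
  \sum_(j < N.*2.+1) (Im (z (freq N j)) * cos ((freq N j)%:~R * w)
                    - Re (z (freq N j)) * sin ((freq N j)%:~R * w)).
Proof.
rewrite /dtft_partial_sum (@big_morph _ _ (@complex.Im R) 0 +%R 0 +%R)//.
  apply: eq_bigr => j _; rewrite -/(freq N j) mulNr [w * _]mulrC /expi cosN sinN.
  by case: (z _) => p q /=; ring.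
by case=> ? ? [].
Qed.

Lemma freq_inj N (j k : nat) : (freq N j - freq N k == 0) = (j == k).
Proof. by rewrite /freq subr_eq0 (inj_eq (addIr _)). Qed.

(** Parseval's identity for a trigonometric polynomial: expanding the square
    produces the differences of frequencies, and only the diagonal has a nonzero
    mean. *)
Lemma has_integral_dtft z N :
  has_integral 0 (2 * pi) (fun w => cmod (dtft_partial_sum z N w) ^+ 2)
    (2 * pi * \sum_(j < N.*2.+1) cmod (z (freq N j)) ^+ 2).
Proof.
pose p j := Re (z (freq N j)); pose q j := Im (z (freq N j)).
have -> : (fun w => cmod (dtft_partial_sum z N w) ^+ 2) = (fun w =>
  \sum_(j < N.*2.+1) \sum_(k < N.*2.+1)
    ((p j * p k + q j * q k) * cos ((freq N j - freq N k)%:~R * w)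
   + (q j * p k - p j * q k) * sin ((freq N j - freq N k)%:~R * w))).
  apply/funext => w; rewrite cmodE Re_dtft Im_dtft !expr2 !big_distrlr /=.
  rewrite -big_split /=; apply: eq_bigr => j _.
  rewrite -big_split /=; apply: eq_bigr => k _.
  rewrite /p /q; move: (freq N j) (freq N k) => m n.
  by rewrite mulrzBr [(_ - _) * w]mulrBl cosB sinB; ring.
have -> : 2 * pi * \sum_(j < N.*2.+1) cmod (z (freq N j)) ^+ 2 =
  \sum_(j < N.*2.+1) \sum_(k < N.*2.+1)
    ((p j * p k + q j * q k) * (2 * pi * (freq N j - freq N k == 0)%:R)
   + (q j * p k - p j * q k) * 0).
  rewrite mulr_sumr; apply: eq_bigr => j _; rewrite (bigD1 j)//= big1 => [|k kj].
    by rewrite subrr eqxx mulr1 cmodE /p /q mulr0; ring.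
  by rewrite freq_inj eq_sym -[(_ == _ :> nat)]/(k == j) (negbTE kj) !mulr0 addr0.
apply: has_integral_sum => j; apply: has_integral_sum => k.
apply: has_integralD; apply: has_integralZ.
  exact: has_integral_cos_period.
exact: has_integral_sin_period.
Qed.

(** The integral of e^{iwn} over [a, b], divided by 2 pi. *)
Definition ideal_coef (a b : R) (n : int) : R[i] :=
  if n == 0 then ((b - a) / (2 * pi))%:C%C
  else Complex ((sin (n%:~R * b) - sin (n%:~R * a)) / n%:~R / (2 * pi))
               ((cos (n%:~R * a) - cos (n%:~R * b)) / n%:~R / (2 * pi)).

Lemma ideal_coef_cos a b n : a < b ->
  has_integral a b (fun w => cos (n%:~R * w)) (2 * pi * Re (ideal_coef a b n)).
Proof.
move=> ab; have p0 : 2 * pi != 0 :> R by rewrite mulf_neq0// gt_eqF ?pi_gt0.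
rewrite /ideal_coef; have [->|n0] /= := eqVneq n 0; rewrite mulrC divfK//.
  under eq_fun do rewrite mul0r cos0.
  by have := has_integral_cst 1 ab; rewrite mul1r.
by apply: has_integral_cosM; rewrite ?intr_eq0.
Qed.

Lemma ideal_coef_sin a b n : a < b ->
  has_integral a b (fun w => sin (n%:~R * w)) (2 * pi * Im (ideal_coef a b n)).
Proof.
move=> ab; have p0 : 2 * pi != 0 :> R by rewrite mulf_neq0// gt_eqF ?pi_gt0.
rewrite /ideal_coef; have [->|n0] /= := eqVneq n 0.
  under eq_fun do rewrite mul0r sin0.
  by have := has_integral_cst 0 ab; rewrite mul0r mulr0.
rewrite mulrC divfK//; by apply: has_integral_sinM; rewrite ?intr_eq0.
Qed.

Lemma has_integral_Re_dtft a b z N : a < b ->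
  has_integral a b (fun w => Re (dtft_partial_sum z N w))
  (2 * pi * \sum_(j < N.*2.+1)
     (Re (z (freq N j)) * Re (ideal_coef a b (freq N j))
    + Im (z (freq N j)) * Im (ideal_coef a b (freq N j)))).
Proof.
move=> ab; under eq_fun do rewrite Re_dtft.
rewrite mulr_sumr; apply: has_integral_sum => j.
rewrite mulrDr ![2 * pi * (_ * _)]mulrCA.
apply: has_integralD; apply: has_integralZ.
  exact: ideal_coef_cos.
exact: ideal_coef_sin.
Qed.

(** Completing the square.  The error is the integral of |S|^2 over a period
    plus that of 1 - 2 Re S over [a, b]; by the choice of [ideal_coef] the
    latter is affine in the real inner product of z with these coefficients. *)
Lemma dtft_error a b z N : 0 < a -> a < b -> b < 2 * pi ->
  (\int[mu]_(w in `]0%R, (2 * pi)%R[)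
     (cmod (dtft_partial_sum z N w - (\1_(`[a, b]) w)%:C%C)%R ^+ 2)%:E =
   (2 * pi * \sum_(j < N.*2.+1) cmod (z (freq N j) - ideal_coef a b (freq N j)) ^+ 2
    + (b - a - 2 * pi * \sum_(j < N.*2.+1) cmod (ideal_coef a b (freq N j)) ^+ 2))%:E)%E.
Proof.
move=> a0 ab b2.
pose S := dtft_partial_sum z N.
have I1 := has_integral_dtft z N.
have I2 := has_integralD (has_integral_cst 1 ab)
  (has_integralZ (- 2) (has_integral_Re_dtft z N ab)).
set v1 := 2 * pi * _ in I1; set v2 := 1 * (b - a) + _ in I2.
pose g w := 1 + - 2 * Re (S w).
pose f1 : R -> \bar R := EFin \o (fun w => cmod (S w) ^+ 2).
pose f2 : R -> \bar R := (EFin \o g) \_ `[a, b].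
have E w : ((cmod (S w - (\1_(`[a, b]) w)%:C%C) ^+ 2)%:E = f1 w + f2 w)%E.
  rewrite /f1 /f2 /patch /= indicE; case: ifPn => _ /=.
    rewrite -EFinD; congr EFin; rewrite !cmodE /g.
    by case: (S w) => x y /=; ring.
  by rewrite subr0 adde0.
have cg : continuous g by exact: I2.1.
have ab2 : `[a, b] `<=` `[0, 2 * pi].
  by move=> x /=; rewrite !in_itv /= => /andP[]; lra.
have i1 : mu.-integrable `[0, 2 * pi] f1 by exact: has_integral_integrable I1.
have i2 : mu.-integrable `[0, 2 * pi] f2.
  have i2' := has_integral_integrable I2.
  apply/integrable_mkcond => //.
  rewrite /f2 -patch_setI (setIidr ab2).
  by rewrite -integrable_mkcond.
under eq_integral do rewrite E.
rewrite -(@integral_itv_bndoo _ 0 (2 * pi) _ true false); last first.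
  apply: (@measurable_funS _ _ _ _ `[0, 2 * pi]) => //; last first.
    by apply: emeasurable_funD; [exact: measurable_int i1|exact: measurable_int i2].
  exact: subset_itv_oo_cc.
rewrite integralD//= -integral_mkcondr (setIidr ab2).
rewrite I1.2 I2.2 -EFinD; congr EFin.
rewrite /v1 /v2.
set s1 := \sum_(j < _) cmod (z _) ^+ 2; set s2 := \sum_(j < _) (_ + _).
set s3 := \sum_(j < _) _ ^+ 2; set s4 := \sum_(j < _) _ ^+ 2.
suff -> : s3 = s1 - 2 * s2 + s4 by ring.
rewrite /s2 mulr_sumr -sumrB -big_split /=; apply: eq_bigr => j _.
rewrite !cmodE; case: (z _) (ideal_coef _ _ _) => ? ? [] ? ? /=; ring.
Qed.

End TrigIntegrals.

(** * Operator norms and the distance to causal filters *)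

Section FilterNorms.
Context {R : realType}.
Implicit Types (h g x : ell2 R).

(** The triangle inequality with constant 1.  Bounding the real and imaginary
    parts separately would cost a factor; instead the sum Z is multiplied by its
    conjugate, so that |Z|^2 is the sum of the real parts of conj(Z) u_k. *)
Lemma cmod_zsum_le_esum (u : int -> R[i]) : zsummable u ->
  cmod (zsum u) <= fine (\esum_(k in setT) (cmod (u k))%:E).
Proof.
move=> su; have fu := summable_fin (fun k => cmod_ge0 (u k)) su.
have [/eqP Z0|Z0] := eqVneq (cmod (zsum u)) 0.
  rewrite (eqP Z0) fine_ge0// esum_ge0// => k _.
  by rewrite lee_fin cmod_ge0.
have {}Z0 : 0 < cmod (zsum u) by rewrite lt_neqAle eq_sym Z0 cmod_ge0.
set Z := zsum u in Z0 *.
rewrite -(ler_pM2l Z0) -expr2 cmodE.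
pose c : R[i] := Complex (Re Z) (- Im Z).
have cZ : cmod c = cmod Z by rewrite /c; case: (Z) => p q /=; rewrite sqrrN.
have su' := zsummableZ c su.
have -> : Re Z ^+ 2 + Im Z ^+ 2 = zsumR (fun k => Re (c * u k)).
  rewrite -[RHS]/(Re (zsum (fun k => c * u k))) zsumZ// -/Z /c.
  by case: (Z) => p q /=; ring.
apply: (le_trans (ler_norm _)).
apply: (le_trans (zsumR_le_norm (zsummable_Re su'))).
rewrite -lee_fin EFinM fineK; last first.
  apply: summable_fin => //.
  by apply: summable_le (zsummable_Re su') => k; rewrite normr_id.
rewrite fineK// -esum_pZl//; apply: le_esum => k _.
by rewrite lee_fin (le_trans (normr_Re _))// cmodM cZ.
Qed.

(** The termwise inequality used is pq <= (H/X) p^2 / 2 + (X/H) q^2 / 2. *)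
Lemma conv_cauchy_schwarz h x n :
  cmod (conv_fun h x n) <= ell2_norm x * ell2_norm h.
Proof.
have sxh := conv_summable x h n.
apply: (le_trans (cmod_zsum_le_esum sxh)).
have E0 (y : ell2 R) k : ell2_norm y = 0 -> cmod (y k) = 0.
  by move=> y0; apply/eqP; rewrite eq_le cmod_ge0 andbT -y0 ell2_norm_ge.
have [x0|xn] := eqVneq (ell2_norm x) 0.
  by rewrite x0 mul0r esum1// => k _; rewrite cmodM E0// mul0r.
have [h0|hn] := eqVneq (ell2_norm h) 0.
  by rewrite h0 mulr0 esum1// => k _; rewrite cmodM [cmod (h _)]E0// mulr0.
set X := ell2_norm x in xn *; set H := ell2_norm h in hn *.
have X0 : 0 < X by rewrite lt_neqAle eq_sym xn sqrtr_ge0.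
have H0 : 0 < H by rewrite lt_neqAle eq_sym hn sqrtr_ge0.
have Er : (\esum_(k in [set: int]) (cmod (h (n - k)) ^+ 2)%:E
    = (H ^+ 2)%:E)%E.
  rewrite -ell2_esumE; apply/esym.
  exact: (reindex_esum setT setT _ (fun k => (cmod (h k) ^+ 2)%:E)
    (set_bij_rev n)).
rewrite -lee_fin fineK; last by apply: summable_fin sxh => k; exact: cmod_ge0.
have -> : ((X * H)%:E =
    \esum_(k in [set: int]) (H / X / 2 * cmod (x k) ^+ 2
      + X / H / 2 * cmod (h (n - k)) ^+ 2)%:E)%E.
  rewrite (@eq_esum _ _ _ _ (fun k => (H / X / 2 * cmod (x k) ^+ 2)%:E
      + (X / H / 2 * cmod (h (n - k)) ^+ 2)%:E)%E)//.
  rewrite esumD; last 2 first.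
  - by move=> k _; rewrite lee_fin mulr_ge0 ?sqr_ge0// !divr_ge0 ?ltW.
  - by move=> k _; rewrite lee_fin mulr_ge0 ?sqr_ge0// !divr_ge0 ?ltW.
  rewrite !esum_pZl ?divr_gt0// ell2_esumE Er -!EFinM -EFinD; congr EFin.
  by rewrite -/X; field; rewrite !gt_eqF.
apply: le_esum => k _; rewrite lee_fin cmodM.
move: (cmod (x k)) (cmod (h (n - k))) => p q.
have -> : H / X / 2 * p ^+ 2 + X / H / 2 * q ^+ 2 =
    p * q + (H * p - X * q) ^+ 2 / (2 * H * X).
  by field; rewrite !gt_eqF.
by rewrite lerDl divr_ge0 ?sqr_ge0// !mulr_ge0 ?ltW.
Qed.

Lemma zsumR_ge0E (F : int -> R) : (forall k, 0 <= F k) ->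
  summable setT (EFin \o F) ->
  zsumR F = fine (\esum_(k in setT) (F k)%:E).
Proof.
move=> F0 sF; rewrite zsumR_posneg//.
under eq_esum do rewrite max_l//.
by rewrite [X in _ - fine X]esum1 ?subr0// => k _; rewrite max_r// oppr_le0.
Qed.

Lemma cmod_conj (z : R[i]) : cmod (conjc z) = cmod z.
Proof. by case: z => p q /=; rewrite sqrrN. Qed.

(** The matched filter input: the unit signal whose response at time 0 attains
    the Cauchy-Schwarz bound.  For h = 0 the inverse is 0 and so is the
    signal. *)
Lemma matched_signal_subproof h :
  (fun k => ((ell2_norm h)^-1)%:C%C * conjc (h (- k))) \in @square_summable R.
Proof.
rewrite inE /=.
have := summableZ (((ell2_norm h)^-1) ^+ 2)
  (summable_bij (set_bij_rev 0) (ell2_summable h)).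
apply: summable_le => k /=; rewrite sub0r cmodM exprMn.
have -> : cmod (((ell2_norm h)^-1)%:C)%C ^+ 2 = ((ell2_norm h)^-1) ^+ 2.
  by rewrite cmodE /= expr0n /= addr0.
by rewrite cmod_conj.
Qed.

Definition matched_signal h := Ell2 (matched_signal_subproof h).

Lemma cmod_matched h k : cmod (matched_signal h k) ^+ 2 =
  (ell2_norm h)^-1 ^+ 2 * cmod (h (- k)) ^+ 2.
Proof.
rewrite /= cmodM exprMn cmod_conj; congr (_ * _).
by rewrite cmodE /= expr0n /= addr0.
Qed.

Lemma esum_rev_ell2 h :
  (\esum_(k in [set: int]) (cmod (h (- k)) ^+ 2)%:E = (ell2_norm h ^+ 2)%:E)%E.
Proof.
rewrite -ell2_esumE [RHS](reindex_esum setT setT _ _ (set_bij_rev 0)).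
by apply: eq_esum => k _; rewrite sub0r.
Qed.

Lemma ell2_norm_matched h : ell2_norm (matched_signal h) <= 1.
Proof.
rewrite -(@ler_sqr _ _ 1) ?nnegrE ?sqrtr_ge0// expr1n ell2_normE.
have [h0|hn] := eqVneq (ell2_norm h) 0.
  rewrite esum1 ?ler01// => k _.
  by rewrite cmod_matched h0 invr0 expr0n mul0r.
under eq_esum do rewrite cmod_matched.
have H0 : 0 < ell2_norm h by rewrite lt_neqAle eq_sym hn sqrtr_ge0.
rewrite esum_pZl ?exprn_gt0 ?invr_gt0// esum_rev_ell2 -EFinM /=.
by rewrite -exprMn mulVf// expr1n.
Qed.

Lemma conv_matched h : conv_fun h (matched_signal h) 0 = (ell2_norm h)%:C%C.
Proof.
have E k : matched_signal h k * h (0 - k) =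
    ((ell2_norm h)^-1 * cmod (h (- k)) ^+ 2)%:C%C.
  rewrite /= sub0r cmodE; case: (h _) => p q; apply/eqP; rewrite eq_complex /=.
  by apply/andP; split; apply/eqP; ring.
have sh : summable setT (EFin \o (fun k => cmod (h (- k)) ^+ 2)).
  have := summable_bij (set_bij_rev 0) (ell2_summable h).
  by apply: summable_le => k /=; rewrite sub0r.
rewrite /conv_fun /zsum; under eq_fun do rewrite E.
under [X in Complex _ (zsumR X)]eq_fun do rewrite E /=.
rewrite /= zsumRZ// zsumR_ge0E//; last by move=> k; exact: sqr_ge0.
rewrite esum_rev_ell2 /= [zsumR _](_ : _ = 0); last first.
  by rewrite zsumR_ge0E ?esum1// /summable esum1 ?ltry//= => k _; rewrite normr0.
congr Complex; have [->|hn] := eqVneq (ell2_norm h) 0; first by rewrite invr0 mul0r.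
by rewrite expr2 mulKf.
Qed.

Lemma ellinf_norm_ge (y : ellinf R) n : cmod (y n) <= ellinf_norm y.
Proof.
apply: ub_le_sup; last by exists n.
by case: y => y /=; rewrite inE /= => -[c yc]; exists c => _ [k _ <-].
Qed.

Lemma conv_ellinf_norm_le h x : ellinf_norm (conv h x) <= ell2_norm x * ell2_norm h.
Proof.
apply: ge_sup; first by exists (cmod (conv h x 0)), 0.
by move=> _ [n _ <-]; exact: conv_cauchy_schwarz.
Qed.

Lemma operator_norm_conv h : operator_norm (conv h) = ell2_norm h.
Proof.
apply/eqP; rewrite eq_le; apply/andP; split.
  apply: ge_sup; first by exists (ellinf_norm (conv h (matched_signal h)));
    exists (matched_signal h) => //; exact: ell2_norm_matched.
  move=> _ [x /= x1 <-]; apply: (le_trans (conv_ellinf_norm_le _ _)).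
  by rewrite ler_piMl// sqrtr_ge0.
apply: (@le_trans _ _ (ellinf_norm (conv h (matched_signal h)))).
  apply: le_trans (ellinf_norm_ge _ 0).
  rewrite -[ellinf_fun _ _]/(conv_fun h (matched_signal h) 0) conv_matched.
  by rewrite /= expr0n /= addr0 sqrtr_sqr ler_norm.
apply: ub_le_sup; last by exists (matched_signal h) => //; exact: ell2_norm_matched.
exists (ell2_norm h) => _ [x /= x1 <-].
apply: (le_trans (conv_ellinf_norm_le _ _)).
by rewrite ler_piMl// sqrtr_ge0.
Qed.


Lemma convB h g : (fun x => conv h x - conv g x) = conv (h - g).
Proof.
apply/funext => x; apply/val_inj/funext => n.
rewrite -[LHS]/(conv_fun h x n - conv_fun g x n) -[RHS]/(conv_fun (h - g) x n).
rewrite -[X in _ + X]mulN1r /conv_fun -zsumZ; last exact: conv_summable.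
rewrite -zsumD; [|exact: conv_summable|exact/zsummableZ/conv_summable].
congr zsum; apply/funext => k; rewrite mulN1r -mulrBr.
by congr (_ * _).
Qed.

Lemma acausal_part_subproof h :
  (fun n : int => if n < 0 then h n else 0) \in @square_summable R.
Proof.
rewrite inE /=; apply: summable_le (ell2_summable h) => k /=.
case: ifP => // _; rewrite cmod0 expr0n /= normr0; exact: normr_ge0.
Qed.

Definition acausal_part h := Ell2 (acausal_part_subproof h).

Lemma ell2_norm_le h g : (forall n, cmod (h n) <= cmod (g n)) ->
  ell2_norm h <= ell2_norm g.
Proof.
move=> hg; rewrite -ler_sqr ?nnegrE ?sqrtr_ge0// -lee_fin -!ell2_esumE.
apply: le_esum => k _; rewrite lee_fin ler_sqr ?nnegrE ?cmod_ge0//.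
Qed.

(** The infimum is attained at the causal part of h. *)
Lemma filter_distance_causal h :
  filter_distance (Lfilter h) causal_filters = ell2_norm (acausal_part h).
Proof.
have E g : operator_norm (fun x => Lfilter h x - Lfilter g x) = ell2_norm (h - g).
  by rewrite -operator_norm_conv -convB.
apply/eqP; rewrite eq_le; apply/andP; split.
  have cg : causal_filters (Lfilter (h - acausal_part h)).
    exists (h - acausal_part h) => // n n0.
    by rewrite -[LHS]/(h n - (if n < 0 then h n else 0)) n0 subrr.
  apply: ge_inf.
    by exists 0 => _ [K [g _ <-] <-]; rewrite E sqrtr_ge0.
  by exists (Lfilter (h - acausal_part h)) => //; rewrite E opprB addrC subrK.
apply: lb_le_inf.
  exists (operator_norm (fun x => Lfilter h x - Lfilter 0 x)).
  by exists (Lfilter 0) => //; exists 0.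
move=> _ [K [g /= cg <-] <-]; rewrite E; apply: ell2_norm_le => n.
change (cmod (if n < 0 then h n else 0) <= cmod (h n - g n)); case: ifP => [n0|_].
  by rewrite cg// subr0.
by rewrite cmod0 cmod_ge0.
Qed.

End FilterNorms.

(** * The ideal filter *)

Section IdealFilter.
Context {R : realType}.

Lemma esum_int (F : int -> \bar R) : (forall n, 0 <= F n)%E ->
  (\esum_(n in [set: int]) F n =
   \esum_(k in [set: nat]) F (Posz k) + \esum_(k in [set: nat]) F (Negz k))%E.
Proof.
move=> F0; rewrite (esumID [set n : int | 0 <= n])//; congr (_ + _)%E.
  apply: reindex_esum; split=> [k _//|j k _ _ [->//]|[k|k] [_]//= _].
  by exists k.
apply: reindex_esum; split=> [k _//|j k _ _ [->//]|[k|k] [_]//= _].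
by exists k.
Qed.

Lemma esum_nat_lim (u : nat -> R) (L : R) : (forall k, 0 <= u k) ->
  (forall n, \sum_(k < n) u k <= L) ->
  (forall e, 0 < e -> exists n, L - e <= \sum_(k < n) u k) ->
  (\esum_(k in [set: nat]) (u k)%:E = L%:E)%E.
Proof.
move=> u0 uL Lu; rewrite -nneseries_esumT => [|k]; last by rewrite lee_fin.
have P n : (\sum_(0 <= k < n) (u k)%:E = (\sum_(k < n) u k)%:E)%E.
  by rewrite sumEFin big_mkord.
apply/eqP; rewrite eq_le; apply/andP; split.
  apply: lime_le; first by apply: is_cvg_nneseries => k _ _; rewrite lee_fin.
  by apply: nearW => n; rewrite P lee_fin.
apply/lee_subgt0Pr => e e0; have [n Hn] := Lu e e0.
rewrite -EFinB; apply: (@le_trans _ _ (\sum_(0 <= k < n) (u k)%:E)%E).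
  by rewrite P lee_fin.
by apply: nneseries_lim_ge => k _ _; rewrite lee_fin.
Qed.

(** Symmetric sums are folded onto positive frequencies; [Negz k] is
    - (k + 1). *)
Lemma sum_freq (F : int -> R) N : \sum_(j < N.*2.+1) F (freq N j) =
  F 0 + \sum_(k < N) (F (Posz k.+1) + F (Negz k)).
Proof.
elim: N => [|N IH]; first by rewrite big_ord1 big_ord0 addr0.
rewrite doubleS big_ord_recl big_ord_recr [in RHS]big_ord_recr /= [RHS]addrA -IH.
rewrite addrCA; congr (_ + _).
  by apply: eq_bigr => j _; congr F; rewrite /freq /= /bump /=; lia.
rewrite addrC; congr (F _ + F _); rewrite /freq /= /bump /=; lia.
Qed.

Implicit Types (a b : R).

Definition ideal_energy a b (n : int) : R := cmod (ideal_coef a b n) ^+ 2.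

Lemma ideal_energyE a b n : n != 0 -> ideal_energy a b n =
  (1 - cos (n%:~R * (b - a))) / n%:~R ^+ 2 / (2 * pi ^+ 2).
Proof.
move=> n0; have m0 : n%:~R != 0 :> R by rewrite intr_eq0.
have p0 : pi != 0 :> R by rewrite gt_eqF ?pi_gt0.
rewrite /ideal_energy cmodE /ideal_coef (negbTE n0) /= mulrBr cosB.
have := cos2Dsin2 (n%:~R * a); have := cos2Dsin2 (n%:~R * b).
move: n%:~R (sin _) (cos _) (sin _) (cos _) (pi : R) m0 p0.
move=> m sb cb sa ca P m0 p0 h1 h2.
apply: (@eq_trans _ _ ((sa ^+ 2 + ca ^+ 2 + (sb ^+ 2 + cb ^+ 2)
   - 2 * (cb * ca + sb * sa)) / m ^+ 2 / (2 * P) ^+ 2)).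
  by field; rewrite p0 m0.
rewrite [sa ^+ 2 + _]addrC [sb ^+ 2 + _]addrC h1 h2.
by field; rewrite p0 m0.
Qed.

Lemma ideal_energy_even a b k :
  ideal_energy a b (Posz k.+1) = ideal_energy a b (Negz k).
Proof. by rewrite !ideal_energyE// NegzE mulrNz mulNr cosN sqrrN. Qed.

Lemma ideal_energy0 a b : ideal_energy a b 0 = ((b - a) / (2 * pi)) ^+ 2.
Proof. by rewrite /ideal_energy cmodE /= expr0n addr0. Qed.

(** The expected energy of the strictly negative times. *)
Definition half_energy a b : R := (b - a) * (2 * pi - (b - a)) / (8 * pi ^+ 2).

Lemma ideal_energy_ge0 a b n : 0 <= ideal_energy a b n.
Proof. exact: sqr_ge0. Qed.

Section Band.
Variables a b : R.
Hypotheses (a0 : 0 < a) (ab : a < b) (b2 : b < 2 * pi).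
Let S (N : nat) : R := \sum_(k < N) ideal_energy a b (Negz k).

(** The Bessel defect is the tail of the energy series. *)
Lemma sum_freq_energy N :
  b - a - 2 * pi * \sum_(j < N.*2.+1) ideal_energy a b (freq N j) =
  4 * pi * (half_energy a b - S N).
Proof.
have p0 : pi != 0 :> R by rewrite gt_eqF ?pi_gt0.
rewrite sum_freq ideal_energy0.
under eq_bigr do rewrite ideal_energy_even -mulr2n -mulr_natl.
rewrite -mulr_sumr -/(S N) /half_energy; move: (pi : R) p0 => P p0.
by field; rewrite p0.
Qed.

(** The L^2 error of the ideal coefficients themselves is nonnegative. *)
Lemma half_energy_bessel N : S N <= half_energy a b.
Proof.
have /(congr1 (fun x => 0%:E <= x)%E) := dtft_error (ideal_coef a b) N a0 ab b2.
rewrite integral_ge0 => [/esym|w _]; last by rewrite lee_fin sqr_ge0.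
rewrite lee_fin big1 => [|j _]; last by rewrite subrr cmod0 expr0n.
rewrite mulr0 add0r sum_freq_energy pmulr_rge0 ?subr_ge0//.
by rewrite mulr_gt0 ?pi_gt0.
Qed.

Lemma half_energy_approx (e : R) : 0 < e -> exists N, half_energy a b - e <= S N.
Proof.
move=> e0; have pi0 : 0 < pi :> R := pi_gt0 R.
have P0 : 0 < 2 * pi ^+ 2 :> R by rewrite mulr_gt0 ?exprn_gt0.
have c2 : 0 < b - a < 2 * pi by move: a0 ab b2; lra.
have [N HN] := bernoulli_series_ge c2 (mulr_gt0 P0 e0).
exists N; rewrite /S; under eq_bigr do
  rewrite ideal_energyE// NegzE mulrNz mulNr cosN sqrrN.
rewrite -mulr_suml ler_pdivlMr//; apply: le_trans HN.
rewrite le_eqVlt; apply/orP; left; apply/eqP; rewrite /half_energy.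
by move: (pi : R) pi0 => P P1; field; rewrite gt_eqF.
Qed.

Lemma esum_ideal_energy_neg :
  (\esum_(k in [set: nat]) (ideal_energy a b (Negz k))%:E = (half_energy a b)%:E)%E.
Proof.
apply: esum_nat_lim => [k||]; first exact: ideal_energy_ge0.
  exact: half_energy_bessel.
exact: half_energy_approx.
Qed.

Lemma esum_ideal_energy :
  (\esum_(n in [set: int]) (ideal_energy a b n)%:E = ((b - a) / (2 * pi))%:E)%E.
Proof.
have p0 : pi != 0 :> R by rewrite gt_eqF ?pi_gt0.
rewrite esum_int => [|n]; last by rewrite lee_fin ideal_energy_ge0.
rewrite esum_ideal_energy_neg.
have -> : (\esum_(k in [set: nat]) (ideal_energy a b (Posz k))%:E =
    (ideal_energy a b 0 + half_energy a b)%:E)%E.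
  have E N : \sum_(k < N.+1) ideal_energy a b (Posz k) = ideal_energy a b 0 + S N.
    rewrite big_ord_recl; congr (_ + _); apply: eq_bigr => k _.
    by rewrite -ideal_energy_even.
  apply: esum_nat_lim => [k|[|n]|e e0]; first exact: ideal_energy_ge0.
  - rewrite big_ord0 addr_ge0 ?ideal_energy_ge0//.
    by have := half_energy_bessel 0; rewrite /S big_ord0.
  - by rewrite E lerD2l half_energy_bessel.
  - have [N HN] := half_energy_approx e0; exists N.+1.
    by rewrite E -addrA lerD2l.
rewrite -EFinD; congr EFin; rewrite ideal_energy0 /half_energy.
by move: (pi : R) p0 => P p0; field; rewrite p0.
Qed.

Lemma ideal_coef_square_summable : ideal_coef a b \in @square_summable R.
Proof.
rewrite inE /= /summable; under eq_esum do rewrite gee0_abs ?lee_fin ?sqr_ge0//.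
by rewrite esum_ideal_energy ltry.
Qed.

Lemma bessel_defect_cvg0 : (4 * pi * (half_energy a b - S N))%:E @[N --> \oo] --> 0%E.
Proof.
have pi0 : 0 < pi :> R := pi_gt0 R.
apply: cvg_EFin; first by apply: nearW.
apply/cvgrPdist_le => e e0.
have [N HN] := @half_energy_approx (e / (4 * pi)) ltac:(by rewrite divr_gt0// mulr_gt0).
exists N => // n /= Nn; rewrite sub0r normrN.
have h := half_energy_bessel n.
have SN : S N <= S n.
  rewrite /S -!(big_mkord xpredT (fun k => ideal_energy a b (Negz k))).
  rewrite (@big_cat_nat _ _ _ N 0 n)//= lerDl sumr_ge0// => *.
  exact: ideal_energy_ge0.
have p4 : 0 < 4 * pi :> R by rewrite mulr_gt0.
rewrite ger0_norm; last by apply: mulr_ge0; [exact: ltW|rewrite subr_ge0].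
by rewrite mulrC -ler_pdivlMr//; lra.
Qed.

Lemma ideal_coef_dtft :
  is_dtft (ideal_coef a b) (fun w => ((\1_(`[a, b]) w)%:C)%C).
Proof.
split=> /=.
- exact: measurable_indic.
- exact: measurable_cst.
- under eq_fun do rewrite (dtft_error _ _ a0 ab b2).
  under eq_fun do (rewrite big1; last by move=> j _; rewrite subrr cmod0 expr0n).
  under eq_fun do rewrite mulr0 add0r sum_freq_energy.
  exact: bessel_defect_cvg0.
Qed.

(** By [dtft_error] and Bessel's inequality, 2 pi |z n - ideal_coef a b n|^2 is
    at most the squared L^2 error of every partial sum that contains the
    frequency n, and these errors tend to 0. *)
Lemma is_dtft_ideal_unique (z : int -> R[i]) :
  is_dtft z (fun w => ((\1_(`[a, b]) w)%:C)%C) -> z = ideal_coef a b.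
Proof.
move=> [_ _]; under eq_fun do rewrite (dtft_error _ _ a0 ab b2) sum_freq_energy.
move=> J; apply/funext => n; apply/eqP; rewrite -subr_eq0; apply/eqP.
apply: ComplexField.Normc.eq0_normc; apply/eqP; rewrite -sqrf_eq0.
have pi0 : 0 < pi :> R := pi_gt0 R.
have : ((2 * pi * cmod (z n - ideal_coef a b n) ^+ 2)%:E <= 0)%E.
  rewrite -(cvg_lim _ J)//; apply: lime_ge; first by apply/cvg_ex; exists 0%E.
  exists `|n|%N => // N /= nN; rewrite lee_fin.
  have hS := half_energy_bessel N.
  have j0 : (absz (n + N%:Z)%R < N.*2.+1)%N by lia.
  rewrite (bigD1 (Ordinal j0))//=.
  have -> : freq N (absz (n + N%:Z)%R) = n by rewrite /freq; lia.
  rewrite [2 * pi * (_ + _)]mulrDr -addrA lerDl addr_ge0// mulr_ge0 ?sumr_ge0 ?subr_ge0//.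
  - by rewrite mulr_ge0 ?ltW.
  - by move=> *; exact: sqr_ge0.
  - by rewrite mulr_ge0 ?ltW.
rewrite lee_fin pmulr_rle0 ?mulr_gt0// => h.
by rewrite eq_le h sqr_ge0.
Qed.

Lemma ideal_responseE : ideal_response a b = ideal_coef a b :> (int -> R[i]).
Proof.
apply: is_dtft_ideal_unique; rewrite /ideal_response.
apply: (@xgetPex _ 0 [set h : ell2 R | is_dtft h (fun w => (\1_(`[a, b]) w)%:C%C)]).
by exists (Ell2 ideal_coef_square_summable); exact: ideal_coef_dtft.
Qed.

Lemma operator_norm_ideal :
  operator_norm (ideal_filter a b) = Num.sqrt ((b - a) / (2 * pi)).
Proof.
rewrite [LHS]operator_norm_conv /ell2_norm ideal_responseE.
by rewrite esum_ideal_energy.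
Qed.

Lemma filter_distance_ideal :
  filter_distance (ideal_filter a b) causal_filters =
  Num.sqrt ((b - a) / (2 * pi)) * Num.sqrt (1 / 2 - (b - a) / (4 * pi)).
Proof.
have pi0 : 0 < pi :> R := pi_gt0 R.
rewrite filter_distance_causal /ell2_norm -sqrtrM; last first.
  by rewrite divr_ge0 ?subr_ge0 ?mulr_ge0 ?ltW.
congr Num.sqrt.
rewrite esum_int => [|n]; last by rewrite lee_fin sqr_ge0.
rewrite esum1 => [|k _]; last first.
  by change ((cmod (0 : R[i]) ^+ 2)%:E = 0%E); rewrite cmod0 expr0n.
rewrite add0e /= ideal_responseE esum_ideal_energy_neg /= /half_energy.
by move: (pi : R) pi0 => P P0; field; rewrite gt_eqF.
Qed.

Lemma filter_angle_ideal :
  filter_angle (ideal_filter a b) causal_filters =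
  asin (Num.sqrt (1 / 2 - (b - a) / (4 * pi))).
Proof.
rewrite /filter_angle filter_distance_ideal operator_norm_ideal mulrC mulKf//.
by rewrite gt_eqF// sqrtr_gt0 divr_gt0 ?subr_gt0// mulr_gt0 ?pi_gt0.
Qed.

End Band.

Lemma sin_piquarter : sin (pi / 4) = Num.sqrt (1 / 2) :> R.
Proof.
have p0 := pi_gt0 R.
have s0 : 0 <= sin (pi / 4) :> R by apply: sin_ge0_pi; lra.
rewrite -[LHS]ger0_norm// -sqrtr_sqr; congr Num.sqrt.
have := cos_pihalf R; have -> : pi / 2 = pi / 4 + pi / 4 :> R by move: (pi : R) => P; field.
rewrite cosD -!expr2; have := cos2Dsin2 (pi / 4 : R).
lra.
Qed.

Lemma asin_sqrt_half : asin (Num.sqrt (1 / 2)) = pi / 4 :> R.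
Proof.
have p0 := pi_gt0 R.
by rewrite -sin_piquarter sinK// in_itv /=; apply/andP; split; lra.
Qed.

Lemma asin_0 : asin 0 = 0 :> R.
Proof.
have p0 := pi_gt0 R.
by rewrite -[X in asin X]sin0 sinK// in_itv /=; apply/andP; split; lra.
Qed.

Lemma asin_gt0_lt_piquarter (s : R) : 0 < s -> s < 1 / 2 ->
  0 < asin (Num.sqrt s) < pi / 4.
Proof.
move=> s0 s1; have p0 := pi_gt0 R.
have q0 : 0 < Num.sqrt s by rewrite sqrtr_gt0.
have qh : Num.sqrt s < Num.sqrt (1 / 2) by rewrite ltr_sqrt.
have q1 : Num.sqrt (1 / 2) <= 1 :> R by rewrite -sin_piquarter sin_le1.
have qI : -1 <= Num.sqrt s <= 1 by lra.
have tl := asin_geNpi2 qI; have tu := asin_lepi2 qI.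
have sq : sin (asin (Num.sqrt s)) = Num.sqrt s by rewrite asinK// in_itv.
rewrite -(@ltr_sin R 0) ?in_itv /=; [|lra|lra].
rewrite -(@ltr_sin R _ (pi / 4)) ?in_itv /=; [|lra|lra].
by rewrite sin0 sq sin_piquarter q0 qh.
Qed.

(** The limit of a function of the bandwidth reduces to continuity at l, which
    may lie outside the range of bandwidths, as 0 and 2 pi do. *)
Lemma cvg_bandwidth (f : R * R -> R) (phi : R -> R) (l : R) :
  (forall a b, 0 < a -> a < b -> b < 2 * pi -> f (a, b) = phi (b - a)) ->
  {for l, continuous phi} ->
  f ab @[ab --> bandwidth_to l] --> phi l.
Proof.
move=> fE cphi V nV; exists (phi @^-1` V); first exact: cphi.
by move=> [a b] [/= a0 ab b2 Vab]; rewrite /= fE.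
Qed.

Lemma continuous_sin_angle :
  continuous (fun c : R => Num.sqrt (1 / 2 - c / (4 * pi))).
Proof.
move=> c; apply: continuous_comp; last exact: sqrt_continuous.
apply: cvgB; first exact: cvg_cst.
by apply: cvgM; [exact: cvg_id|exact: cvg_cst].
Qed.

End IdealFilter.

Theorem theorem6 (R : realType) :
  let theta (a b : R) := filter_angle (ideal_filter a b) causal_filters in
  let dist (a b : R) := filter_distance (ideal_filter a b) causal_filters in
  (forall a b : R, 0 < a -> a < b -> b < 2 * pi ->
    theta a b = asin (Num.sqrt (1 / 2 - (b - a) / (4 * pi))) /\
    dist a b = Num.sqrt ((b - a) / (2 * pi))
               * Num.sqrt (1 / 2 - (b - a) / (4 * pi))) /\
  (forall a b a' b' : R, 0 < a -> a < b -> b < 2 * pi ->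
    0 < a' -> a' < b' -> b' < 2 * pi -> b - a = b' - a' ->
    theta a b = theta a' b' /\ dist a b = dist a' b') /\
  ((forall a b : R, 0 < a -> a < b -> b < 2 * pi -> 0 < theta a b < pi / 4) /\
   theta ab.1 ab.2 @[ab --> bandwidth_to 0] --> pi / 4 /\
   theta ab.1 ab.2 @[ab --> bandwidth_to (2 * pi)] --> (0 : R)) /\
  (dist ab.1 ab.2 @[ab --> bandwidth_to 0] --> (0 : R) /\
   dist ab.1 ab.2 @[ab --> bandwidth_to (2 * pi)] --> (0 : R)).
Proof.
move=> theta dist; have pi0 : 0 < pi :> R := pi_gt0 R.
pose s (c : R) : R := Num.sqrt (1 / 2 - c / (4 * pi)).
have thetaE (a b : R) : 0 < a -> a < b -> b < 2 * pi -> theta a b = asin (s (b - a)).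
  exact: filter_angle_ideal.
have distE (a b : R) : 0 < a -> a < b -> b < 2 * pi ->
    dist a b = Num.sqrt ((b - a) / (2 * pi)) * s (b - a).
  exact: filter_distance_ideal.
have s0 : s 0 = Num.sqrt (1 / 2) by rewrite /s mul0r subr0.
have s2 : s (2 * pi) = 0.
  rewrite /s (_ : _ - _ = 0) ?sqrtr0//.
  by move: (pi : R) pi0 => P P0; field; rewrite gt_eqF.
have cs : continuous s by exact: continuous_sin_angle.
have cd : continuous (fun c : R => Num.sqrt (c / (2 * pi)) * s c).
  move=> l; apply: cvgM; last exact: cs.
  apply: (@continuous_comp _ _ _ (fun c : R => c / (2 * pi)) Num.sqrt).
    by apply: cvgM; [exact: cvg_id|exact: cvg_cst].
  exact: sqrt_continuous.
have h1 : Num.sqrt (1 / 2) < 1 :> R by rewrite -[ltRHS]sqrtr1 ltr_sqrt//; lra.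
have h0 : 0 <= Num.sqrt (1 / 2) :> R by exact: sqrtr_ge0.
have ct (l : R) : -1 < s l < 1 -> {for l, continuous (asin \o s)}.
  move=> sl; apply: continuous_comp; first exact: cs.
  exact: continuous_asin.
split; first by move=> a b a0 ab b2; split; [exact: thetaE|exact: distE].
split.
  move=> a b a' b' a0 ab b2 a0' ab' b2' E.
  by rewrite (thetaE _ _ a0 ab b2) (thetaE _ _ a0' ab' b2')
    (distE _ _ a0 ab b2) (distE _ _ a0' ab' b2') E.
split; [split; [|split]|split].
- move=> a b a0 ab b2; rewrite thetaE//; apply: asin_gt0_lt_piquarter.
    by rewrite subr_gt0 ltr_pdivrMr ?mulr_gt0//; lra.
  by rewrite gtrBl divr_gt0 ?subr_gt0 ?mulr_gt0.
- rewrite -asin_sqrt_half -s0; apply: (@cvg_bandwidth _ _ (asin \o s)).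
    by move=> a b *; exact: thetaE.
  by apply: ct; rewrite s0; lra.
- rewrite -asin_0 -s2; apply: (@cvg_bandwidth _ _ (asin \o s)).
    by move=> a b *; exact: thetaE.
  by apply: ct; rewrite s2; lra.
- have := @cvg_bandwidth _ (fun ab => dist ab.1 ab.2) _ _ distE (cd 0).
  by rewrite mul0r sqrtr0 mul0r.
- have := @cvg_bandwidth _ (fun ab => dist ab.1 ab.2) _ _ distE (cd (2 * pi)).
  by rewrite s2 mulr0.
Qed.
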